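(* The Hopf algebras $(H,\sqcup\!\sqcup_{\square},\Delta)$, $(H,\sqcup\!\sqcup,\Delta)$ and $(H,\sqcup\!\sqcup^{\mathsf{qs}},\Delta)$ on matrix compositions (block shuffle, two-parameter shuffle and two-parameter quasi-shuffle, each with the coproduct $\Delta$ of deconcatenation along the diagonal) are isomorphic: $(H,\sqcup\!\sqcup_{\square},\Delta)\cong(H,\sqcup\!\sqcup,\Delta)\cong(H,\sqcup\!\sqcup^{\mathsf{qs}},\Delta)$ as Hopf algebras.
   Context: $\mathbb{K}$ is a commutative $\mathbb{Q}$-algebra, $d\ge 1$, and $(\mathfrak{M}_d,\star,\varepsilon)$ is the free commutative monoid generated by $d$ letters, with neutral element $\varepsilon$. A matrix composition is either the empty composition $\mathsf{e}$ (with $0$ rows and $0$ columns) or a matrix of size $m\times n$, $m,n\ge 1$, with entries in $\mathfrak{M}_d$ having no row and no column consisting only of $\varepsilon$. $\mathrm{Comp}$ is the set of matrix compositions and $H=\bigoplus_{\mathbf{a}\in\mathrm{Comp}}\mathbb{K}\mathbf{a}$. For $\mathbf{a},\mathbf{b}\in\mathrm{Comp}$, $\mathrm{diag}(\mathbf{a},\mathbf{b})$ is the block diagonal matrix with blocks $\mathbf{a},\mathbf{b}$ and all off-diagonal-block entries equal to $\varepsilon$; $\mathsf{e}$ is neutral for $\mathrm{diag}$; $\mathrm{diag}$ is extended bilinearly to $H$. A nonempty $\mathbf{c}\in\mathrm{Comp}$ is connected if $\mathbf{c}=\mathrm{diag}(\mathbf{a},\mathbf{b})$ implies $\mathbf{a}=\mathsf{e}$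 or $\mathbf{b}=\mathsf{e}$. Every nonempty composition is uniquely $\mathrm{diag}(\mathbf{u}_1,\dots,\mathbf{u}_\ell)$ with all $\mathbf{u}_i$ connected. The coproduct $\Delta:H\to H\otimes H$ is linear with $\Delta(\mathsf{e})=\mathsf{e}\otimes\mathsf{e}$ and $\Delta(\mathrm{diag}(\mathbf{u}_1,\dots,\mathbf{u}_\ell))=\sum_{\alpha=0}^{\ell}\mathrm{diag}(\mathbf{u}_1,\dots,\mathbf{u}_\alpha)\otimes\mathrm{diag}(\mathbf{u}_{\alpha+1},\dots,\mathbf{u}_\ell)$ for connected $\mathbf{u}_i$ (an empty $\mathrm{diag}$ is $\mathsf{e}$). The unit is $\mathsf{e}$; the counit sends $\mathsf{e}\mapsto 1$ and every nonempty composition to $0$. Products on $H$ (all bilinear with neutral element $\mathsf{e}$): (1) Block shuffle $\sqcup\!\sqcup_{\square}$: $\mathrm{diag}(\mathbf{a},\mathbf{u})\sqcup\!\sqcup_{\square}\mathrm{diag}(\mathbf{b},\mathbf{v})=\mathrm{diag}(\mathbf{a},\mathbf{u}\sqcup\!\sqcup_{\square}\mathrm{diag}(\mathbf{b},\mathbf{v}))+\mathrm{diag}(\mathbf{b},\mathrm{diag}(\mathbf{a},\mathbf{u})\sqcup\!\sqcup_{\square}\mathbf{v})$ for connected $\mathbf{a},\mathbf{b}$ and $\mathbf{u},\mathbf{v}\in\mathrm{Comp}$ (i.e. the classical shuffle product on words over the alphabet of connected compositions). (2) Two-parameter shuffle $\sqcup\!\sqcup$: for nonempty $\mathbf{a}$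 (size $m\times n$), $\mathbf{b}$ (size $s\times t$), $\mathbf{a}\sqcup\!\sqcup\mathbf{b}=\sum_{p\in\mathrm{sh}(m,s)}\sum_{q\in\mathrm{sh}(n,t)}(\mathrm{diag}(\mathbf{a},\mathbf{b})_{p^{-1}(u),q^{-1}(v)})_{u,v}$, where $\mathrm{sh}(m,s)$ is the set of permutations $q$ of $\{1,\dots,m+s\}$ with $q(1)<\dots<q(m)$ and $q(m+1)<\dots<q(m+s)$. (3) Two-parameter quasi-shuffle $\sqcup\!\sqcup^{\mathsf{qs}}$: for nonempty $\mathbf{a}$ (size $m\times n$), $\mathbf{b}$ (size $s\times t$), $\mathbf{a}\sqcup\!\sqcup^{\mathsf{qs}}\mathbf{b}=\sum_{j,k\ge1}\sum_{p\in\mathrm{qsh}(m,s;j)}\sum_{q\in\mathrm{qsh}(n,t;k)}\mathbf{c}^{p,q}$, where $\mathbf{c}^{p,q}$ is the $j\times k$ matrix with entries $\mathbf{c}^{p,q}_{x,y}=\bigstar_{u\in p^{-1}(x),\,v\in q^{-1}(y)}\mathrm{diag}(\mathbf{a},\mathbf{b})_{u,v}$, and $\mathrm{qsh}(m,s;j)$ is the set of surjections $q:\{1,\dots,m+s\}\to\{1,\dots,j\}$ with $q(1)<\dots<q(m)$ and $q(m+1)<\dots<q(m+s)$. With each of these products, $H$ together with $\Delta$ is a graded connected commutative Hopf algebra (graded by the total number of letters in the entries). *)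

(* Defs.v *)
From Stdlib Require Import Classical ClassicalEpsilon.
From HB Require Import structures.
From mathcomp Require Import all_boot all_fingroup all_algebra.
From mathcomp Require Import finmap monalg.

Set Implicit Arguments.
Unset Strict Implicit.
Unset Printing Implicit Defensive.

Import GRing.Theory.
Local Open Scope ring_scope.

(* ** Free modules, tensor products and Hopf algebras.

   [{malg K[X]}] is the free K-module with basis X; the basis element of x is
   [<< x >>] and the coefficient of f at x is [f@_x].  The tensor product of
   the free modules on X and Y is the free module on X * Y, the pure tensor of
   the basis elements x and y being [<< (x, y) >>]. *)
Section FreeModule.
Variable K : comNzRingType.

(* Linear and bilinear extensions of maps given on a basis. *)
Definition lin_ext (X : choiceType) (V : lmodType K) (f : X -> V)
    (x : {malg K[X]}) : V :=
  \sum_(a <- msupp x) x@_a *: f a.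

Definition bilin_ext (X Y : choiceType) (V : lmodType K) (f : X -> Y -> V)
    (x : {malg K[X]}) (y : {malg K[Y]}) : V :=
  \sum_(a <- msupp x) \sum_(b <- msupp y) (x@_a * y@_b) *: f a b.

Definition tensor (X Y : choiceType) :
    {malg K[X]} -> {malg K[Y]} -> {malg K[(X * Y)%type]} :=
  bilin_ext (fun a b => << (a, b) >>).

Definition tensor_map (X X' Y Y' : choiceType)
    (f : {malg K[X]} -> {malg K[X']}) (g : {malg K[Y]} -> {malg K[Y']}) :
    {malg K[(X * Y)%type]} -> {malg K[(X' * Y')%type]} :=
  lin_ext (fun p => tensor (f << p.1 >>) (g << p.2 >>)).

Definition tensor_assoc (X Y Z : choiceType) :
    {malg K[(X * (Y * Z))%type]} -> {malg K[((X * Y) * Z)%type]} :=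
  lin_ext (fun p => << ((p.1, p.2.1), p.2.2) >>).

(* The linear map from the tensor product induced by a bilinear map. *)
Definition tensor_lift (X Y : choiceType) (V : lmodType K)
    (m : {malg K[X]} -> {malg K[Y]} -> V) : {malg K[(X * Y)%type]} -> V :=
  lin_ext (fun p => m << p.1 >> << p.2 >>).

End FreeModule.

Section Hopf.
Variables (K : comNzRingType) (X : choiceType).
Local Notation H := {malg K[X]}.
Local Notation HH := {malg K[(X * X)%type]}.

Record hopf_ops := HopfOps {
  hone : H;
  hmul : H -> H -> H;
  hcomul : H -> HH;
  hcounit : H -> K
}.

Definition tensor_mul (mul : H -> H -> H) : HH -> HH -> HH :=
  bilin_ext (fun p q =>
    tensor (mul << p.1 >> << q.1 >>) (mul << p.2 >> << q.2 >>)).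

Definition is_antipode (A : hopf_ops) (S : H -> H) : Prop :=
  [/\ linear S,
      (forall x, tensor_lift (hmul A) (tensor_map S id (hcomul A x))
                 = hcounit A x *: hone A)
    & (forall x, tensor_lift (hmul A) (tensor_map id S (hcomul A x))
                 = hcounit A x *: hone A)].

Record is_hopf (A : hopf_ops) : Prop := IsHopf {
  hmul_linearr : forall x, linear (hmul A x);
  hmul_linearl : forall y, linear (hmul A ^~ y);
  hmulA : associative (hmul A);
  hmul1 : left_id (hone A) (hmul A);
  hmulr1 : right_id (hone A) (hmul A);
  hcomul_linear : linear (hcomul A);
  hcounit_linear : scalar (hcounit A);
  hcomulA : forall x,
    tensor_map (hcomul A) id (hcomul A x)
    = tensor_assoc (tensor_map id (hcomul A) (hcomul A x));
  hcounitl : forall x,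
    tensor_lift (fun y z => hcounit A y *: z) (hcomul A x) = x;
  hcounitr : forall x,
    tensor_lift (fun y z => hcounit A z *: y) (hcomul A x) = x;
  hcomul1 : hcomul A (hone A) = tensor (hone A) (hone A);
  hcomulM : forall x y,
    hcomul A (hmul A x y) = tensor_mul (hmul A) (hcomul A x) (hcomul A y);
  hcounit1 : hcounit A (hone A) = 1;
  hcounitM : {morph hcounit A : x y / hmul A x y >-> x * y};
  hantipode : exists S, is_antipode A S
}.

Record hopf_morphism (A B : hopf_ops) (phi : H -> H) : Prop := HopfMorphism {
  hmor_linear : linear phi;
  hmor_one : phi (hone A) = hone B;
  hmor_mul : {morph phi : x y / hmul A x y >-> hmul B x y};
  hmor_comul : forall x, hcomul B (phi x) = tensor_map phi phi (hcomul A x);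
  hmor_counit : forall x, hcounit B (phi x) = hcounit A x;
  hmor_antipode : forall S T, is_antipode A S -> is_antipode B T ->
    forall x, phi (S x) = T (phi x)
}.

Definition hopf_isomorphic (A B : hopf_ops) : Prop :=
  [/\ is_hopf A, is_hopf B
    & exists phi : H -> H, hopf_morphism A B phi /\ bijective phi].

End Hopf.

(* ** Matrix compositions with entries in a commutative monoid M. *)
Section Composition.
Variable M : conomType.

(* For m = 0 this forces n = 0 and conversely, an empty row or column being
   constantly equal to the neutral element; hence a composition is either the
   0 x 0 matrix or has m, n >= 1. *)
Definition is_mcomp (m n : nat) (A : 'M[M]_(m, n)) : bool :=
  [forall i, exists j, A i j != mone] && [forall j, exists i, A i j != mone].

Lemma is_mcompP (m n : nat) (A : 'M[M]_(m, n)) :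
  reflect ((forall i, exists j, A i j != mone) /\
           (forall j, exists i, A i j != mone)) (is_mcomp A).
Proof.
apply: (iffP andP) => -[hr hc]; split.
- by move=> i; apply/existsP; move/forallP: hr.
- by move=> j; apply/existsP; move/forallP: hc.
- by apply/forallP => i; apply/existsP.
- by apply/forallP => j; apply/existsP.
Qed.

Record mcomp := MComp {
  nrow : nat;
  ncol : nat;
  cmx :> 'M[M]_(nrow, ncol);
  mcompP : is_mcomp cmx
}.

Definition mcomp_tag (c : mcomp) : {p : nat * nat & 'M[M]_(p.1, p.2)} :=
  existT (fun p : nat * nat => 'M[M]_(p.1, p.2)) (nrow c, ncol c) (cmx c).

Definition mcomp_untag (x : {p : nat * nat & 'M[M]_(p.1, p.2)}) :
    option mcomp :=
  if @idP (is_mcomp (tagged x)) is ReflectT h then Some (MComp h) else None.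

Lemma mcomp_tagK : pcancel mcomp_tag mcomp_untag.
Proof.
case=> m n A hA; rewrite /mcomp_untag /=.
case: {-}_ / idP => [h|//]; congr (Some (MComp _)); exact: bool_irrelevance.
Qed.

HB.instance Definition _ := Choice.copy mcomp (pcan_type mcomp_tagK).

Lemma mcomp0_proof : is_mcomp (const_mx mone : 'M[M]_(0, 0)).
Proof. by apply/is_mcompP; split=> -[]. Qed.

Definition mcomp0 : mcomp := MComp mcomp0_proof.

Lemma diag_proof (a b : mcomp) :
  is_mcomp (block_mx a (const_mx mone) (const_mx mone) b).
Proof.
have [/is_mcompP[ra ca] /is_mcompP[rb cb]] := (mcompP a, mcompP b).
apply/is_mcompP; split=> k; case: (split_ordP k) => i ->.
- by have [j h] := ra i; exists (lshift _ j); rewrite block_mxEul.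
- by have [j h] := rb i; exists (rshift _ j); rewrite block_mxEdr.
- by have [j h] := ca i; exists (lshift _ j); rewrite block_mxEul.
- by have [j h] := cb i; exists (rshift _ j); rewrite block_mxEdr.
Qed.

Definition diag (a b : mcomp) : mcomp := MComp (diag_proof a b).

Definition diags (us : seq mcomp) : mcomp := foldr diag mcomp0 us.

Definition connected (c : mcomp) : Prop :=
  c <> mcomp0 /\ forall a b, c = diag a b -> a = mcomp0 \/ b = mcomp0.

(* The decomposition of c into connected compositions; it exists and is unique
   by [blocksP] and [blocks_diags] below. *)
Definition blocks (c : mcomp) : seq mcomp :=
  epsilon (inhabits [::])
    (fun us => {in us, forall u, connected u} /\ c = diags us).

(* [entry c i j] extends the matrix c by the neutral element to all i, j. *)
Definition entry (c : mcomp) (i j : nat) : M :=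
  if @idP (i < nrow c)%N is ReflectT hi then
    if @idP (j < ncol c)%N is ReflectT hj then c (Ordinal hi) (Ordinal hj)
    else mone
  else mone.

Lemma entry_ord (c : mcomp) (i : 'I_(nrow c)) (j : 'I_(ncol c)) :
  entry c i j = c i j.
Proof.
rewrite /entry; case: {-}_ / idP => [hi|]; last by rewrite ltn_ord.
case: {-}_ / idP => [hj|]; last by rewrite ltn_ord.
by congr (cmx c _ _); apply: val_inj.
Qed.

Lemma entry_row (c : mcomp) i j : (nrow c <= i)%N -> entry c i j = mone.
Proof.
by move=> h; rewrite /entry; case: {-}_ / idP => // hi; have := hi; rewrite ltnNge h.
Qed.

Lemma entry_col (c : mcomp) i j : (ncol c <= j)%N -> entry c i j = mone.
Proof.
move=> h; rewrite /entry; case: {-}_ / idP => // hi.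
by case: {-}_ / idP => // hj; have := hj; rewrite ltnNge h.
Qed.

Lemma entry_inj (a b : mcomp) : nrow a = nrow b -> ncol a = ncol b ->
  (forall i j, entry a i j = entry b i j) -> a = b.
Proof.
move=> hr hc hE.
case: a b hr hc hE => m n A hA [m' n' B hB] /= hr hc.
case: m' / hr B hB => B hB; case: n' / hc B hB => B hB hE.
have eAB : A = B.
  apply/matrixP => i j.
  by have := hE i j; rewrite (entry_ord (c := MComp hA)) (entry_ord (c := MComp hB)).
by case: B / eAB hB {hE} => hB; congr MComp; apply: bool_irrelevance.
Qed.

Lemma entry_row_neq (c : mcomp) i : (i < nrow c)%N ->
  exists2 j, (j < ncol c)%N & entry c i j != mone.
Proof.
move=> hi; have [/(_ (Ordinal hi))[j hj] _] := is_mcompP _ (mcompP c).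
by exists j => //; rewrite -[i]/(val (Ordinal hi)) entry_ord.
Qed.

Lemma entry_col_neq (c : mcomp) j : (j < ncol c)%N ->
  exists2 i, (i < nrow c)%N & entry c i j != mone.
Proof.
move=> hj; have [_ /(_ (Ordinal hj))[i hi]] := is_mcompP _ (mcompP c).
by exists i => //; rewrite -[j]/(val (Ordinal hj)) entry_ord.
Qed.

Lemma entry_diag (a b : mcomp) i j : entry (diag a b) i j =
  if (i < nrow a)%N then if (j < ncol a)%N then entry a i j else mone
  else if (j < ncol a)%N then mone else entry b (i - nrow a) (j - ncol a).
Proof.
have [hi|hi] := leqP (nrow a + nrow b) i.
  rewrite entry_row // ltnNge (leq_trans (leq_addr _ _) hi) /=.
  by case: ifP => // _; rewrite entry_row // leq_subRL ?(leq_trans (leq_addr _ _) hi).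
have [hj|hj] := leqP (ncol a + ncol b) j.
  rewrite entry_col // [(j < _)%N]ltnNge (leq_trans (leq_addr _ _) hj) /=.
  by case: ifP => // _; rewrite entry_col // leq_subRL ?(leq_trans (leq_addr _ _) hj).
have [I <-] : exists I : 'I_(nrow a + nrow b), I = i :> nat by exists (Ordinal hi).
have [J <-] : exists J : 'I_(ncol a + ncol b), J = j :> nat by exists (Ordinal hj).
rewrite (entry_ord (c := diag a b)) [cmx _]/=.
case: (split_ordP I) => k ->; case: (split_ordP J) => l -> /=.
- by rewrite block_mxEul entry_ord.
- by rewrite block_mxEur mxE.
- by rewrite block_mxEdl mxE.
- by rewrite block_mxEdr !addKn entry_ord.
Qed.

Lemma diag0c : left_id mcomp0 diag.
Proof.
move=> c; apply: entry_inj => //= i j.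
by rewrite entry_diag /= !subn0.
Qed.

Lemma diagc0 : right_id mcomp0 diag.
Proof.
move=> c; apply: entry_inj; rewrite /= ?addn0 // => i j.
rewrite entry_diag; case: ltnP => hi; case: ltnP => hj //.
- by rewrite entry_col.
- by rewrite entry_row.
- by rewrite !entry_row.
Qed.

Lemma diagA : associative diag.
Proof.
move=> a b c; apply: entry_inj; rewrite /= ?addnA // => i j.
rewrite !entry_diag /=.
have [hi|hi] := ltnP i (nrow a); have [hj|hj] := ltnP j (ncol a).
- by rewrite !(leq_trans _ (leq_addr _ _)).
- by rewrite (leq_trans hi (leq_addr _ _)); case: ifP.
- by rewrite (leq_trans hj (leq_addr _ _)); case: ifP.
- by rewrite !ltn_subLR // !subnDA.
Qed.

HB.instance Definition _ := Monoid.isLaw.Build mcomp mcomp0 diag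
  diagA diag0c diagc0.

Lemma nrow_eq0 (c : mcomp) : nrow c = 0%N -> c = mcomp0.
Proof.
move=> h; have hc : ncol c = 0%N.
  case E: (ncol c) => [//|k].
  have [] := @entry_col_neq c 0%N; first by rewrite E.
  by move=> i; rewrite h.
by apply: entry_inj => // i j; rewrite !entry_row // h.
Qed.

Lemma diag_refine (a b c d : mcomp) : (nrow a <= nrow c)%N ->
  diag a b = diag c d -> exists x, c = diag a x /\ b = diag x d.
Proof.
move=> hr E.
have hE i j : entry (diag a b) i j = entry (diag c d) i j by rewrite E.
have hR : (nrow a + nrow b = nrow c + nrow d)%N := congr1 nrow E.
have hC : (ncol a + ncol b = ncol c + ncol d)%N := congr1 ncol E.
have hc : (ncol a <= ncol c)%N.
  rewrite leqNgt; apply/negP => lt.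
  have [i hi] := entry_col_neq lt.
  have := hE i (ncol c); rewrite !entry_diag hi lt (leq_trans hi hr) ltnn.
  by move=> ->; rewrite eqxx.
pose A := \matrix_(i < nrow c - nrow a, j < ncol c - ncol a)
  entry c (nrow a + i) (ncol a + j).
have hA : is_mcomp A.
  apply/is_mcompP; split=> [i|j].
    have hi : (nrow a + i < nrow c)%N by rewrite -ltn_subRL.
    have [j hj hn] := entry_row_neq hi.
    have := hE (nrow a + i)%N j.
    rewrite !entry_diag hi hj ltnNge leq_addr /=.
    case: ltnP => [_ e|haj _]; first by rewrite -e eqxx in hn.
    have hj' : (j - ncol a < ncol c - ncol a)%N by rewrite ltn_sub2r // (leq_ltn_trans haj).
    by exists (Ordinal hj'); rewrite mxE /= subnKC.
  have hj : (ncol a + j < ncol c)%N by rewrite -ltn_subRL.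
  have [i hi hn] := entry_col_neq hj.
  have := hE i (ncol a + j)%N.
  rewrite !entry_diag hi hj [(ncol a + j < _)%N]ltnNge leq_addr /=.
  case: ltnP => [_ e|hai _]; first by rewrite -e eqxx in hn.
  have hi' : (i - nrow a < nrow c - nrow a)%N by rewrite ltn_sub2r // (leq_ltn_trans hai).
  by exists (Ordinal hi'); rewrite mxE /= subnKC.
have eA i j : entry (MComp hA) i j = entry c (nrow a + i) (ncol a + j).
  have [hi|hi] := ltnP i (nrow c - nrow a); last first.
    by rewrite !entry_row //= -leq_subLR.
  have [hj|hj] := ltnP j (ncol c - ncol a); last first.
    by rewrite !entry_col //= -leq_subLR.
  rewrite -[i in LHS]/(val (Ordinal hi)) -[j in LHS]/(val (Ordinal hj)).
  by rewrite (entry_ord (c := MComp hA)) mxE.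
exists (MComp hA); split.
  apply: entry_inj; rewrite /= ?subnKC // => i j.
  rewrite entry_diag eA; have := hE i j; rewrite !entry_diag.
  have [hi|hi] := ltnP i (nrow a); have [hj|hj] := ltnP j (ncol a).
  - by rewrite (leq_trans hi hr) (leq_trans hj hc).
  - rewrite (leq_trans hi hr); case: ltnP => [_ -> //|h _].
    by rewrite entry_col.
  - rewrite (leq_trans hj hc); case: ltnP => [_ -> //|h _].
    by rewrite entry_row.
  - by rewrite !subnKC.
apply: entry_inj => [||i j] /=.
- by rewrite addnC addnBA // addnC -hR addKn.
- by rewrite addnC addnBA // addnC -hC addKn.
rewrite entry_diag eA /=; have := hE (nrow a + i)%N (ncol a + j)%N.
rewrite !entry_diag ![(_ + _ < nrow a)%N]ltnNge ![(_ + _ < ncol a)%N]ltnNge.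
rewrite !leq_addr /= !addKn => ->; rewrite -!ltn_subRL.
by rewrite !subnBA // ![(_ + nrow a)%N]addnC ![(_ + ncol a)%N]addnC.
Qed.

Lemma connected_nrow (c : mcomp) : connected c -> (0 < nrow c)%N.
Proof. by case=> h _; rewrite lt0n; apply/eqP => /nrow_eq0. Qed.

Lemma connected_neq0 (c : mcomp) : connected c -> c <> mcomp0.
Proof. by case. Qed.

Lemma diagI (a b d : mcomp) : diag a b = diag a d -> b = d.
Proof.
move=> /(diag_refine (leqnn _))[x [e ->]].
suff -> : x = mcomp0 by rewrite diag0c.
by apply: nrow_eq0; apply/eqP; rewrite -(eqn_add2l (nrow a)) addn0 {2}e.
Qed.

Lemma diag_connectedI (u v b d : mcomp) : connected u -> connected v ->
  diag u b = diag v d -> u = v /\ b = d.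
Proof.
move=> cu cv E.
wlog le : u v b d cu cv E / (nrow u <= nrow v)%N.
  move=> IH; case/orP: (leq_total (nrow u) (nrow v)) => le; first exact: IH.
  by have [-> ->] := IH _ _ _ _ cv cu (esym E) le.
have [x [e1 e2]] := diag_refine le E.
case: (cv.2 _ _ e1) => [u0|x0]; first by case: cu.
by rewrite e1 e2 x0 diagc0 diag0c.
Qed.

Lemma diags_connected_inj (us vs : seq mcomp) :
  {in us, forall u, connected u} -> {in vs, forall v, connected v} ->
  diags us = diags vs -> us = vs.
Proof.
elim: us vs => [|u us IH] [|v vs] //= hu hv.
- have := connected_nrow (hv v (mem_head _ _)).
  by move=> h /(congr1 nrow) /= e; move: h; rewrite lt0n; case: (nrow v) e.
- have := connected_nrow (hu u (mem_head _ _)).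
  by move=> h /(congr1 nrow) /= e; move: h; rewrite lt0n; case: (nrow u) e.
move=> /(diag_connectedI (hu u (mem_head _ _)) (hv v (mem_head _ _)))[-> e].
congr (_ :: _); apply: IH => // w hw; [apply: hu|apply: hv];
  by rewrite inE hw orbT.
Qed.

Lemma diags_cat (us vs : seq mcomp) :
  diags (us ++ vs) = diag (diags us) (diags vs).
Proof. by elim: us => [|u us IH] /=; rewrite ?diag0c // IH diagA. Qed.

Lemma blocks_exist (c : mcomp) :
  exists us, {in us, forall u, connected u} /\ c = diags us.
Proof.
elim: {c}(nrow c).+1 {-2}c (ltnSn (nrow c)) => // n IH c hc.
case: (classic (c = mcomp0)) => [->|c0]; first by exists [::].
case: (classic (connected c)) => [cc|nc].
  by exists [:: c]; split=> [u|]; rewrite /= ?diagc0 // inE => /eqP ->.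
have [a [b [e [a0 b0]]]] :
    exists a b, c = diag a b /\ (a <> mcomp0 /\ b <> mcomp0).
  apply: NNPP => H; apply: nc; split=> // a b e.
  apply: NNPP => H'; apply: H; exists a, b; split=> //.
  by split=> h; apply: H'; [left|right].
have ha : (0 < nrow a)%N by rewrite lt0n; apply/eqP => /nrow_eq0.
have hb : (0 < nrow b)%N by rewrite lt0n; apply/eqP => /nrow_eq0.
have hn : (nrow a + nrow b <= n)%N by move: hc; rewrite e.
have [|us [hu ea]] := IH a.
  by rewrite (leq_trans _ hn) // -addn1 leq_add2l.
have [|vs [hv eb]] := IH b.
  by rewrite (leq_trans _ hn) // -add1n leq_add2r.
exists (us ++ vs); rewrite diags_cat -ea -eb; split=> // u.
by rewrite mem_cat => /orP[/hu|/hv].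
Qed.

Lemma blocksP (c : mcomp) :
  {in blocks c, forall u, connected u} /\ c = diags (blocks c).
Proof. exact: epsilon_spec (blocks_exist c). Qed.

Lemma blocks_diags (us : seq mcomp) :
  {in us, forall u, connected u} -> blocks (diags us) = us.
Proof.
move=> hu; have [h e] := blocksP (diags us).
by apply: diags_connected_inj h hu (esym e).
Qed.

Lemma blocks_diag_connected (a u : mcomp) :
  connected a -> blocks (diag a u) = a :: blocks u.
Proof.
move=> ca; have [h e] := blocksP u; rewrite {1}e.
apply: (@blocks_diags (a :: blocks u)) => v.
by rewrite inE => /orP[/eqP->|/h].
Qed.

End Composition.

(* ** The three products on the free module H over matrix compositions, and
   deconcatenation along the diagonal. *)
Section Products.
Variables (K : comNzRingType) (M : conomType).
Local Notation H := {malg K[mcomp M]}.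
Local Notation HH := {malg K[(mcomp M * mcomp M)%type]}.
Implicit Types a b c : mcomp M.

Definition deconc_basis c : HH :=
  let us := blocks c in
  \sum_(0 <= k < (size us).+1) << (diags (take k us), diags (drop k us)) >>.

Definition deconc : H -> HH := lin_ext deconc_basis.

Definition counit : H -> K := fun x => x@_(mcomp0 M).

Lemma deconc_basisE (us : seq (mcomp M)) :
  {in us, forall u, connected u} ->
  deconc_basis (diags us) =
  \sum_(0 <= k < (size us).+1) << (diags (take k us), diags (drop k us)) >>.
Proof. by move=> hu; rewrite /deconc_basis blocks_diags. Qed.

Definition diag_lin : H -> H -> H := bilin_ext (fun a b => << diag a b >>).

(* The recursion of the block shuffle, on words of connected compositions. *)
Fixpoint bshuffle_words (us : seq (mcomp M)) : seq (mcomp M) -> H :=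
  if us is a :: us' then
    fix bshuffle_us vs : H :=
      if vs is b :: vs' then
        diag_lin << a >> (bshuffle_words us' vs)
        + diag_lin << b >> (bshuffle_us vs')
      else << diags us >>
  else fun vs => << diags vs >>.

Definition bshuffle_basis a b : H := bshuffle_words (blocks a) (blocks b).

Definition bshuffle : H -> H -> H := bilin_ext bshuffle_basis.

Lemma blocks0 : blocks (mcomp0 M) = [::].
Proof. exact: (@blocks_diags M [::]). Qed.

Lemma bshuffle_basis0c a : bshuffle_basis (mcomp0 M) a = << a >>.
Proof. by rewrite /bshuffle_basis blocks0 /= -(blocksP a).2. Qed.

Lemma bshuffle_basisc0 a : bshuffle_basis a (mcomp0 M) = << a >>.
Proof.
rewrite /bshuffle_basis blocks0 [in RHS](blocksP a).2.
by case: (blocks a).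
Qed.

Lemma bshuffle_basis_diag a b (u v : mcomp M) : connected a -> connected b ->
  bshuffle_basis (diag a u) (diag b v) =
  diag_lin << a >> (bshuffle_basis u (diag b v))
  + diag_lin << b >> (bshuffle_basis (diag a u) v).
Proof.
by move=> ca cb; rewrite /bshuffle_basis !blocks_diag_connected.
Qed.

Definition sh (m s : nat) : {set 'S_(m + s)} :=
  [set p : 'S_(m + s) |
    [forall i : 'I_m, forall j : 'I_m,
       (i < j)%N ==> (p (lshift s i) < p (lshift s j))%N] &&
    [forall i : 'I_s, forall j : 'I_s,
       (i < j)%N ==> (p (rshift m i) < p (rshift m j))%N]].

Lemma mcomp_perm_proof c (p : 'S_(nrow c)) (q : 'S_(ncol c)) :
  is_mcomp (\matrix_(x, y) c ((p^-1)%g x) ((q^-1)%g y)).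
Proof.
have [hr hc] := is_mcompP _ (mcompP c).
apply/is_mcompP; split=> k.
- have [l hl] := hr ((p^-1)%g k); exists (q l); by rewrite mxE permK.
- have [l hl] := hc ((q^-1)%g k); exists (p l); by rewrite mxE permK.
Qed.

Definition mcomp_perm c (p : 'S_(nrow c)) (q : 'S_(ncol c)) : mcomp M :=
  MComp (mcomp_perm_proof p q).

Definition shuffle2_basis a b : H :=
  if a == mcomp0 M then << b >> else if b == mcomp0 M then << a >> else
  \sum_(p in sh (nrow a) (nrow b)) \sum_(q in sh (ncol a) (ncol b))
    << @mcomp_perm (diag a b) p q >>.

Definition shuffle2 : H -> H -> H := bilin_ext shuffle2_basis.

Definition surjb (n j : nat) (q : {ffun 'I_n -> 'I_j}) : bool :=
  [forall x, exists i, q i == x].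

Definition is_qsh (m s j : nat) (q : {ffun 'I_(m + s) -> 'I_j}) : bool :=
  [&& surjb q,
      [forall i : 'I_m, forall i' : 'I_m,
         (i < i')%N ==> (q (lshift s i) < q (lshift s i'))%N] &
      [forall i : 'I_s, forall i' : 'I_s,
         (i < i')%N ==> (q (rshift m i) < q (rshift m i'))%N]].

Definition qsh (m s j : nat) : Type :=
  {q : {ffun 'I_(m + s) -> 'I_j} | is_qsh q}.
HB.instance Definition _ m s j := Finite.on (qsh m s j).

Lemma qsh_surj m s j (q : qsh m s j) : surjb (val q).
Proof. by case/and3P: (valP q). Qed.

(* Hence the sums over j and k in [qshuffle2_basis] leave out no term. *)
Lemma qsh_le m s j : qsh m s j -> (j <= m + s)%N.
Proof.
move=> q; have /forallP h := qsh_surj q.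
pose f x := xchoose (existsP (h x)).
have fK : cancel f (val q) by move=> x; apply/eqP/(xchooseP (existsP (h x))).
by have := leq_card f (can_inj fK); rewrite !card_ord.
Qed.

Lemma mcomp_merge_proof c (j k : nat) (p : {ffun 'I_(nrow c) -> 'I_j})
    (q : {ffun 'I_(ncol c) -> 'I_k}) : surjb p -> surjb q ->
  is_mcomp (\matrix_(x, y) \big[@mmul M/mone]_(u | p u == x)
                             \big[@mmul M/mone]_(v | q v == y) c u v).
Proof.
move=> /forallP hp /forallP hq.
have neq u v : c u v != mone ->
    \big[@mmul M/mone]_(u' | p u' == p u)
      \big[@mmul M/mone]_(v' | q v' == q v) c u' v' != mone.
  move=> h; rewrite (bigD1 u) //= (bigD1 v) //=.
  by apply/eqP => /unitm[/unitm[e _] _]; rewrite e eqxx in h.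
have [hr hc] := is_mcompP _ (mcompP c).
apply/is_mcompP; split=> z.
- have /existsP[u /eqP <-] := hp z; have [v hv] := hr u.
  by exists (q v); rewrite mxE neq.
- have /existsP[v /eqP <-] := hq z; have [u hu] := hc v.
  by exists (p u); rewrite mxE neq.
Qed.

Definition mcomp_merge c (j k : nat) (p : {ffun 'I_(nrow c) -> 'I_j})
    (q : {ffun 'I_(ncol c) -> 'I_k}) (hp : surjb p) (hq : surjb q) : mcomp M :=
  MComp (mcomp_merge_proof hp hq).

Definition qshuffle2_basis a b : H :=
  if a == mcomp0 M then << b >> else if b == mcomp0 M then << a >> else
  \sum_(1 <= j < (nrow a + nrow b).+1) \sum_(1 <= k < (ncol a + ncol b).+1)
    \sum_(p : qsh (nrow a) (nrow b) j) \sum_(q : qsh (ncol a) (ncol b) k)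
      << @mcomp_merge (diag a b) j k (val p) (val q)
           (qsh_surj p) (qsh_surj q) >>.

Definition qshuffle2 : H -> H -> H := bilin_ext qshuffle2_basis.

Definition mcomp_hopf (mul : H -> H -> H) : hopf_ops K (mcomp M) :=
  HopfOps << mcomp0 M >> mul deconc counit.

End Products.

(* Main.v *)
Require Import Defs.
From HB Require Import structures.
From mathcomp Require Import all_boot all_fingroup all_algebra.
From mathcomp Require Import finmap monalg.

Set Implicit Arguments.
Unset Strict Implicit.
Unset Printing Implicit Defensive.

Import GRing.Theory.
Local Open Scope ring_scope.

(** Write V for the span of the connected compositions.  Every composition is a
    unique word in connected ones, so H with deconcatenation is the cofree
    (tensor) coalgebra on V, and the block shuffle is the shuffle product of
    words.  Over a commutative Q-algebra every commutative product on this
    coalgebra that is compatible with deconcatenation and graded by a weight is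
    isomorphic to the shuffle product; both isomorphisms follow by comparing the
    shuffle and the quasi-shuffle with the block shuffle.

    The general statement is [block_shuffle_iso].  Let degree multiply each
    composition by its weight and let D solve id * D = degree for the convolution
    product, so that D is the Dynkin operator S * degree, S being the antipode.
    Since degree is a derivation, D kills products of nonempty compositions, and
    on a connected composition it is multiplication by the weight
    ([dynkin_exists]).  Projecting D to V and dividing by the weight gives a map f
    that is the identity on V and kills products.  By cofreeness f extends to a
    unique coalgebra map F, which sends a word to the sum over its factorisations
    w1 ... wk of the words f(w1) ... f(wk).  As f kills products, F is
    multiplicative; as f is the identity on V, the map F is the identity up to
    words with fewer letters, hence bijective.  The Hopf algebra axioms of the
    block shuffle are transported along F; antipodes exist and are preserved
    because the coalgebra is connected ([compat_antipode], [bialgebra_map_hopf]).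

    For the quasi-shuffle, a composition a is evaluated in the monoid algebra of
    N x L matrices as the sum of all matrices from which a arises by deleting
    trivial rows and columns.  Two increasing maps into N rows factor uniquely
    through the union of their images, which says precisely that evaluation turns
    the quasi-shuffle into the product of a commutative associative algebra
    ([ev_qshuffle2]).  Keeping the block diagonal matrices only is again
    multiplicative and turns evaluation into deconcatenation ([block_part_ev]),
    whence compatibility with the coproduct.  The weight is the number of letters.

    The shuffle product is the top component of the quasi-shuffle product for the
    filtration by the number of rows plus the number of columns
    ([shuffle2_top]), so its properties are those of the associated graded
    algebra. *)

(** * Linear and bilinear extension *)

Section LinearExtension.
Variable K : comNzRingType.

Lemma lin_extEw (X : choiceType) (V : lmodType K) (f : X -> V)
    (d : {fset X}) (x : {malg K[X]}) :
  (msupp x `<=` d)%fset -> lin_ext f x = \sum_(a <- d) x@_a *: f a.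
Proof.
move=> sub; apply: big_fset_incl => // a _ /mcoeff_outdom ->.
by rewrite scale0r.
Qed.

Lemma lin_ext_linear (X : choiceType) (V : lmodType K) (f : X -> V) :
  linear (lin_ext f).
Proof.
move=> k x y; pose d := (msupp x `|` msupp y `|` msupp (k *: x + y))%fset.
rewrite !(@lin_extEw _ _ f d) ?/d;
  try by rewrite ?fsubsetUr // -fsetUA ?fsubsetUl // fsetUCA fsubsetUl.
rewrite scaler_sumr -big_split /=; apply: eq_bigr => a _.
by rewrite mcoeffD mcoeffZ scalerDl scalerA.
Qed.

End LinearExtension.

(** Sealed copies of the basis elements and of the linear and bilinear
    extensions: comparing two distinct basis elements by unfolding their finite
    supports is intractable for the conversion test. *)
HB.lock Definition bas (K : comNzRingType) (X : choiceType) (a : X) :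
  {malg K[X]} := << a >>.
HB.lock Definition linext (K : comNzRingType) (X : choiceType) (V : lmodType K)
  (f : X -> V) := lin_ext f.
HB.lock Definition bilinext (K : comNzRingType) (X Y : choiceType)
  (V : lmodType K) (f : X -> Y -> V) := bilin_ext f.

Local Notation "<< a >>" := (bas _ a) : ring_scope.

Definition tens (K : comNzRingType) (X Y : choiceType) :
    {malg K[X]} -> {malg K[Y]} -> {malg K[(X * Y)%type]} :=
  bilinext (fun a b => << (a, b) >>).

Section SealedExtension.
Variable K : comNzRingType.

Lemma basE (X : choiceType) (a : X) : << 1 *g a >> = << a >> :> {malg K[X]}.
Proof. by rewrite bas.unlock. Qed.

Lemma lin_extE (X : choiceType) (V : lmodType K) (f : X -> V) :
  lin_ext f = linext f.
Proof. by rewrite linext.unlock. Qed.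

Lemma bilin_extE (X Y : choiceType) (V : lmodType K) (f : X -> Y -> V) :
  bilin_ext f = bilinext f.
Proof. by rewrite bilinext.unlock. Qed.

Lemma tensorE (X Y : choiceType) : @tensor K X Y = @tens K X Y.
Proof. by rewrite /tens bas.unlock -bilin_extE. Qed.

Lemma linext_linear (X : choiceType) (V : lmodType K) (f : X -> V) :
  linear (linext f).
Proof. by rewrite -lin_extE; exact: lin_ext_linear. Qed.

HB.instance Definition _ (X : choiceType) (V : lmodType K) (f : X -> V) :=
  GRing.isLinear.Build K {malg K[X]} V _ (linext f) (linext_linear f).

Lemma linextU (X : choiceType) (V : lmodType K) (f : X -> V) a :
  linext f << a >> = f a.
Proof.
by rewrite -basE -lin_extE /lin_ext msuppU oner_eq0 big_seq_fset1 mcoeffUU scale1r.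
Qed.

Lemma mcoeff_basis (X : choiceType) (a b : X) :
  (<< a >> : {malg K[X]})@_b = (a == b)%:R.
Proof. by rewrite -basE; exact: mcoeffU. Qed.

Lemma linear_Prop_sum (V W : lmodType K) (f : V -> W) (I : Type) (r : seq I)
    (P : pred I) (F : I -> V) :
  linear f -> f (\sum_(i <- r | P i) F i) = \sum_(i <- r | P i) f (F i).
Proof.
move=> hf; pose g : {linear V -> W} := HB.pack f (GRing.isLinear.Build _ _ _ _ f hf).
exact: (linear_sum g).
Qed.

Lemma linear_Prop0 (V W : lmodType K) (f : V -> W) : linear f -> f 0 = 0.
Proof.
move=> hf; pose g : {linear V -> W} := HB.pack f (GRing.isLinear.Build _ _ _ _ f hf).
exact: (linear0 g).
Qed.

Lemma linear_PropZ (V W : lmodType K) (f : V -> W) k x :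
  linear f -> f (k *: x) = k *: f x.
Proof.
move=> hf; pose g : {linear V -> W} := HB.pack f (GRing.isLinear.Build _ _ _ _ f hf).
exact: (linearZ_LR g).
Qed.

Lemma malg_basisE (X : choiceType) (x : {malg K[X]}) :
  x = \sum_(a <- msupp x) x@_a *: << a >>.
Proof.
rewrite [LHS]monalgE; apply: eq_bigr => a _.
by apply/malgP => b; rewrite mcoeffZ mcoeff_basis mcoeffU mulr_natr.
Qed.

Lemma linextE_linear (X : choiceType) (V : lmodType K) (f : {malg K[X]} -> V) :
  linear f -> f =1 linext (fun a => f << a >>).
Proof.
move=> hf x; rewrite {1}[x]malg_basisE linear_Prop_sum //.
by rewrite -lin_extE; apply: eq_bigr => a _; rewrite linear_PropZ.
Qed.

Lemma eq_on_basis (X : choiceType) (V : lmodType K) (f g : {malg K[X]} -> V) :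
  linear f -> linear g -> (forall a, f << a >> = g << a >>) ->
  forall x, f x = g x.
Proof.
move=> hf hg e x; rewrite (linextE_linear hf) (linextE_linear hg).
by rewrite -!lin_extE; apply: eq_bigr => a _; rewrite e.
Qed.

Section Bilinear.
Variables (X Y : choiceType) (V : lmodType K) (f : X -> Y -> V).

Lemma bilinextE x y :
  bilinext f x y = linext (fun a => linext (f a) y) x.
Proof.
rewrite -bilin_extE -(lin_extE (fun a => _)); apply: eq_bigr => a _.
rewrite -(lin_extE (f a)) /lin_ext scaler_sumr; apply: eq_bigr => b _.
by rewrite scalerA.
Qed.

Lemma bilinext_linearl y : linear (fun x => bilinext f x y).
Proof. by move=> k u v; rewrite !bilinextE linearP. Qed.

Lemma bilinext_linearr x : linear (bilinext f x).
Proof.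
move=> k u v; rewrite !bilinextE -!(lin_extE (fun a => linext (f a) _)).
rewrite /lin_ext scaler_sumr -big_split; apply: eq_bigr => a _ /=.
by rewrite linearP scalerDr !scalerA mulrC.
Qed.

Lemma bilinextPl k u v y :
  bilinext f (k *: u + v) y = k *: bilinext f u y + bilinext f v y.
Proof. exact: bilinext_linearl. Qed.

Lemma bilinextPr k x u v :
  bilinext f x (k *: u + v) = k *: bilinext f x u + bilinext f x v.
Proof. exact: bilinext_linearr. Qed.

Lemma bilinextUU a b : bilinext f << a >> << b >> = f a b.
Proof. by rewrite bilinextE !linextU. Qed.

Lemma bilinext0l y : bilinext f 0 y = 0.
Proof. exact: (linear_Prop0 (bilinext_linearl y)). Qed.

Lemma bilinext0r x : bilinext f x 0 = 0.
Proof. exact: (linear_Prop0 (bilinext_linearr x)). Qed.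

Lemma bilinextDl u v y :
  bilinext f (u + v) y = bilinext f u y + bilinext f v y.
Proof. by rewrite -[u]scale1r bilinextPl !scale1r. Qed.

Lemma bilinextDr x u v :
  bilinext f x (u + v) = bilinext f x u + bilinext f x v.
Proof. by rewrite -[u]scale1r bilinextPr !scale1r. Qed.

Lemma bilinextZl k x y : bilinext f (k *: x) y = k *: bilinext f x y.
Proof. exact: (linear_PropZ _ _ (bilinext_linearl y)). Qed.

Lemma bilinextZr k x y : bilinext f x (k *: y) = k *: bilinext f x y.
Proof. exact: (linear_PropZ _ _ (bilinext_linearr x)). Qed.

Lemma bilinextNl x y : bilinext f (- x) y = - bilinext f x y.
Proof. by rewrite -[- x]scaleN1r bilinextZl scaleN1r. Qed.

Lemma bilinextNr x y : bilinext f x (- y) = - bilinext f x y.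
Proof. by rewrite -[- y]scaleN1r bilinextZr scaleN1r. Qed.

End Bilinear.

Lemma eq_on_basis2 (X Y : choiceType) (V : lmodType K)
    (f g : {malg K[X]} -> {malg K[Y]} -> V) :
  (forall x, linear (f x)) -> (forall y, linear (f ^~ y)) ->
  (forall x, linear (g x)) -> (forall y, linear (g ^~ y)) ->
  (forall a b, f << a >> << b >> = g << a >> << b >>) ->
  forall x y, f x y = g x y.
Proof.
move=> fr fl gr gl e x y; move: x; apply: eq_on_basis => // a.
by move: y; apply: eq_on_basis.
Qed.

Lemma tensUU (X Y : choiceType) (a : X) (b : Y) :
  tens (<< a >> : {malg K[X]}) << b >> = << (a, b) >>.
Proof. by rewrite /tens bilinextUU. Qed.

Lemma mcoeff_linear (X : choiceType) (a : X) : scalar (mcoeff a : {malg K[X]} -> K).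
Proof. by move=> k x y; rewrite mcoeffD mcoeffZ. Qed.

Lemma mcoeff_tens (X Y : choiceType) (x : {malg K[X]}) (y : {malg K[Y]}) a b :
  (tens x y)@_(a, b) = x@_a * y@_b.
Proof.
apply: (@eq_on_basis2 X Y K^o (fun x y => (tens x y)@_(a, b))
  (fun x y => x@_a * y@_b)) => [u|v|u|v|c d].
- by move=> k w z; rewrite /tens bilinextPr mcoeff_linear.
- by move=> k w z; rewrite /tens bilinextPl mcoeff_linear.
- by move=> k w z; rewrite mcoeff_linear mulrDr mulrCA.
- by move=> k w z; rewrite mcoeff_linear mulrDl -mulrA.
by rewrite tensUU !mcoeff_basis -natrM mulnb xpair_eqE.
Qed.

Lemma tensor_mapE (X X' Y Y' : choiceType) (f : {malg K[X]} -> {malg K[X']})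
    (g : {malg K[Y]} -> {malg K[Y']}) :
  tensor_map f g = linext (fun p => tens (f << p.1 >>) (g << p.2 >>)).
Proof. by rewrite bas.unlock -lin_extE -tensorE. Qed.

Lemma tensor_liftE (X Y : choiceType) (V : lmodType K)
    (m : {malg K[X]} -> {malg K[Y]} -> V) :
  tensor_lift m = linext (fun p => m << p.1 >> << p.2 >>).
Proof. by rewrite bas.unlock -lin_extE. Qed.

Lemma tensor_assocE (X Y Z : choiceType) :
  @tensor_assoc K X Y Z = linext (fun p => << ((p.1, p.2.1), p.2.2) >>).
Proof. by rewrite bas.unlock -lin_extE. Qed.

Lemma tensor_mulE (X : choiceType)
    (m : {malg K[X]} -> {malg K[X]} -> {malg K[X]}) :
  tensor_mul m = bilinext (fun p q =>
    tens (m << p.1 >> << q.1 >>) (m << p.2 >> << q.2 >>)).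
Proof. by rewrite bas.unlock -bilin_extE -tensorE. Qed.

Lemma tensor_mapT (X X' Y Y' : choiceType) (f : {malg K[X]} -> {malg K[X']})
    (g : {malg K[Y]} -> {malg K[Y']}) x y : linear f -> linear g ->
  tensor_map f g (tens x y) = tens (f x) (g y).
Proof.
rewrite tensor_mapE => hf hg; move: x y; apply: eq_on_basis2 => [x|y|x|y|a b] /=.
- by move=> k u v; rewrite /tens bilinextPr linearP.
- by move=> k u v; rewrite /tens bilinextPl linearP.
- by move=> k u v; rewrite hg /tens bilinextPr.
- by move=> k u v; rewrite hf /tens bilinextPl.
- by rewrite tensUU linextU.
Qed.

Lemma tensor_liftT (X Y : choiceType) (V : lmodType K)
    (m : {malg K[X]} -> {malg K[Y]} -> V) x y :
  (forall x, linear (m x)) -> (forall y, linear (m ^~ y)) ->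
  tensor_lift m (tens x y) = m x y.
Proof.
rewrite tensor_liftE => hr hl; move: x y; apply: eq_on_basis2 => [x|y|x|y|a b] //=.
- by move=> k u v; rewrite /tens bilinextPr linearP.
- by move=> k u v; rewrite /tens bilinextPl linearP.
- by rewrite tensUU linextU.
Qed.

End SealedExtension.

(** * Sums over the factorisations of a composition *)

Section Factorisations.
Variable M : conomType.
Implicit Types a b c u w : mcomp M.

Lemma mcomp_ind_diag (P : mcomp M -> Prop) :
  P (mcomp0 M) ->
  (forall u w, connected u -> P w -> P (diag u w)) -> forall c, P c.
Proof.
move=> P0 PS c; have [h ->] := blocksP c.
elim: (blocks c) h => //= u us IH h; apply: PS; first exact/h/mem_head.
by apply: IH => v hv; apply: h; rewrite inE hv orbT.
Qed.

Lemma nrow_gt0 c : c != mcomp0 M -> (0 < nrow c)%N.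
Proof. by rewrite lt0n; apply: contra => /eqP/nrow_eq0 ->. Qed.

Lemma diag_eq0 a b : (diag a b == mcomp0 M) = (a == mcomp0 M) && (b == mcomp0 M).
Proof.
apply/eqP/andP => [e|[/eqP-> /eqP->]]; last by rewrite diag0c.
have /eqP := congr1 (@nrow M) e; rewrite /= addn_eq0 => /andP[/eqP ha /eqP hb].
by rewrite (nrow_eq0 ha) (nrow_eq0 hb).
Qed.

Lemma connected_eq0 u : connected u -> (u == mcomp0 M) = false.
Proof. by move=> /connected_neq0/eqP/negbTE. Qed.

(** The factorisations c = diag a b are the cuts of the word of blocks of c. *)
Definition dsum (V : nmodType) c (phi : mcomp M -> mcomp M -> V) : V :=
  let us := blocks c in
  \sum_(0 <= k < (size us).+1) phi (diags (take k us)) (diags (drop k us)).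

Section DsumNmod.
Variable V : nmodType.
Implicit Types phi psi : mcomp M -> mcomp M -> V.

Lemma dsum0 phi : dsum (mcomp0 M) phi = phi (mcomp0 M) (mcomp0 M).
Proof. by rewrite /dsum blocks0 big_nat1. Qed.

Lemma dsum_diag u w phi : connected u ->
  dsum (diag u w) phi =
  phi (mcomp0 M) (diag u w) + dsum w (fun a b => phi (diag u a) b).
Proof.
move=> cu; rewrite /dsum blocks_diag_connected //= big_nat_recl //=.
by rewrite -(blocksP w).2.
Qed.

Lemma eq_dsum c phi psi :
  (forall a b, c = diag a b -> phi a b = psi a b) -> dsum c phi = dsum c psi.
Proof.
move=> e; apply: eq_bigr => k _; apply: e.
by rewrite -diags_cat cat_take_drop -(blocksP c).2.
Qed.

Lemma dsumD c phi psi :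
  dsum c (fun a b => phi a b + psi a b) = dsum c phi + dsum c psi.
Proof. exact: big_split. Qed.

Lemma exchange_dsum c d (phi : mcomp M -> mcomp M -> mcomp M -> mcomp M -> V) :
  dsum c (fun a b => dsum d (fun a' b' => phi a b a' b')) =
  dsum d (fun a' b' => dsum c (fun a b => phi a b a' b')).
Proof. exact: exchange_big. Qed.

Lemma dsum_eq0 c phi : (forall a b, c = diag a b -> phi a b = 0) -> dsum c phi = 0.
Proof. by move=> h; rewrite (eq_dsum h); exact: big1. Qed.

Lemma dsum_left c phi : (forall a b, a != mcomp0 M -> phi a b = 0) ->
  dsum c phi = phi (mcomp0 M) c.
Proof.
move=> h; elim/mcomp_ind_diag: c => [|u w cu _]; first exact: dsum0.
rewrite dsum_diag // dsum_eq0 ?addr0 // => a b _.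
by rewrite h // diag_eq0 connected_eq0.
Qed.

Lemma dsum_right c phi : (forall a b, b != mcomp0 M -> phi a b = 0) ->
  dsum c phi = phi c (mcomp0 M).
Proof.
elim/mcomp_ind_diag: c phi => [|u w cu IH] phi h; first exact: dsum0.
have e0 : phi (mcomp0 M) (diag u w) = 0 by rewrite h // diag_eq0 connected_eq0.
rewrite dsum_diag // e0 add0r.
by apply: IH => a b; apply: h.
Qed.

Lemma dsum_leftP c phi :
  (forall a b, c = diag a b -> a != mcomp0 M -> phi a b = 0) ->
  dsum c phi = phi (mcomp0 M) c.
Proof.
move=> h; rewrite (@eq_dsum _ _ (fun a b => if a == mcomp0 M then phi a b else 0)).
  by rewrite dsum_left ?eqxx // => a b /negbTE->.
by move=> a b /h; case: eqP => // _ ->.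
Qed.

Lemma dsum_rightP c phi :
  (forall a b, c = diag a b -> b != mcomp0 M -> phi a b = 0) ->
  dsum c phi = phi c (mcomp0 M).
Proof.
move=> h; rewrite (@eq_dsum _ _ (fun a b => if b == mcomp0 M then phi a b else 0)).
  by rewrite dsum_right ?eqxx // => a b /negbTE->.
by move=> a b /h; case: eqP => // _ ->.
Qed.

Lemma dsum_split_left c phi :
  dsum c phi = phi (mcomp0 M) c
             + dsum c (fun a b => if a == mcomp0 M then 0 else phi a b).
Proof.
have := @dsum_left c (fun a b => if a == mcomp0 M then phi a b else 0).
rewrite eqxx => <- => [|a b /negbTE -> //].
rewrite -dsumD; apply: eq_dsum => a b _.
by case: ifP; rewrite ?addr0 ?add0r.
Qed.

(** Both sides run over the factorisations of c into three factors. *)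
Lemma dsumA c (phi : mcomp M -> mcomp M -> mcomp M -> V) :
  dsum c (fun a b => dsum a (fun x y => phi x y b)) =
  dsum c (fun x w => dsum w (fun y z => phi x y z)).
Proof.
elim/mcomp_ind_diag: c phi => [|u w cu IH] phi; first by rewrite !dsum0.
rewrite !dsum_diag // dsum0 -addrA; congr (_ + _).
under eq_dsum => a b _ do rewrite dsum_diag //.
rewrite dsumD; congr (_ + _).
exact: (IH (fun x y z => phi (diag u x) y z)).
Qed.

End DsumNmod.

Lemma linear_dsum (K : comNzRingType) (V W : lmodType K) (f : V -> W) c phi :
  linear f -> f (dsum c phi) = dsum c (fun a b => f (phi a b)).
Proof. exact: linear_Prop_sum. Qed.

Lemma dsum_scalel (K : comNzRingType) (V : lmodType K) k c
    (phi : mcomp M -> mcomp M -> V) :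
  k *: dsum c phi = dsum c (fun a b => k *: phi a b).
Proof. exact: scaler_sumr. Qed.

Lemma dsum_pick_left (K : comNzRingType) (V : lmodType K) c
    (phi : mcomp M -> mcomp M -> V) :
  dsum c (fun a b => (a == mcomp0 M)%:R *: phi a b) = phi (mcomp0 M) c.
Proof.
rewrite (@dsum_left _ _ (fun a b => (a == mcomp0 M)%:R *: phi a b)) ?eqxx ?scale1r //.
by move=> a b /negbTE ->; rewrite scale0r.
Qed.

Lemma dsum_pick_right (K : comNzRingType) (V : lmodType K) c
    (phi : mcomp M -> mcomp M -> V) :
  dsum c (fun a b => (b == mcomp0 M)%:R *: phi a b) = phi c (mcomp0 M).
Proof.
rewrite (@dsum_right _ _ (fun a b => (b == mcomp0 M)%:R *: phi a b)) ?eqxx ?scale1r //.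
by move=> a b /negbTE ->; rewrite scale0r.
Qed.

(** Well-founded recursion along the proper right factors of a composition. *)
Lemma dsum_rec (V : nmodType) (E : mcomp M -> V) (B : mcomp M -> V -> V) :
  exists f : mcomp M -> V, forall c,
    f c = E c + dsum c (fun a b => if a == mcomp0 M then 0 else B a (f b)).
Proof.
pose step (f : mcomp M -> V) c :=
  E c + dsum c (fun a b => if a == mcomp0 M then 0 else B a (f b)).
have stable n m c : (nrow c < n)%N -> (nrow c < m)%N ->
    iter n step (fun=> 0) c = iter m step (fun=> 0) c.
  elim: n m c => // n IH [//|m] c hn hm /=; congr (_ + _).
  apply: eq_dsum => a b e; case: eqVneq => // /nrow_gt0 a0.
  have lt : (nrow b < nrow c)%N by rewrite e /= -[ltnLHS]add0n ltn_add2r.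
  by rewrite (IH m) // (leq_trans lt).
exists (fun c => iter (nrow c).+1 step (fun=> 0) c) => c.
rewrite iterS; congr (_ + _); apply: eq_dsum => a b e.
case: eqVneq => // /nrow_gt0 a0; congr (B a _); apply: stable => //.
by rewrite e /= -[ltnLHS]add0n ltn_add2r.
Qed.

(** Deconcatenation is dual to diag: a pair of compositions is obtained by
    cutting their diagonal sum, and in one way only. *)
Lemma dsum_pair_coeff (K : comNzRingType) c c1 c2 :
  (dsum c (fun a b => << (a, b) >> : {malg K[(mcomp M * mcomp M)%type]}))@_(c1, c2)
  = (c == diag c1 c2)%:R.
Proof.
rewrite (@linear_dsum _ _ K^o (mcoeff (c1, c2))); last exact: mcoeff_linear.
rewrite (@eq_dsum _ _ _ (fun a b => ((a == c1) && (b == c2))%:R)); last first.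
  by move=> a b _; rewrite mcoeff_basis xpair_eqE.
elim/mcomp_ind_diag: c1 c => [|v c1 cv IH] c.
  rewrite diag0c (@dsum_left _ _ (fun a b => ((a == _) && (b == c2))%:R)) ?eqxx //.
  by move=> a b /negbTE ->.
elim/mcomp_ind_diag: c => [|u w cu _].
  by rewrite dsum0 -diagA ![mcomp0 M == _]eq_sym !diag_eq0 connected_eq0.
rewrite dsum_diag // eq_sym diag_eq0 connected_eq0 //= add0r.
have eqd a b : (diag u a == diag v b) = (u == v) && (a == b).
  apply/eqP/andP => [/(diag_connectedI cu cv)[-> ->]|[/eqP-> /eqP->]] //.
rewrite -diagA eqd; case uv: (u == v) => /=; last first.
  by apply: dsum_eq0 => a b _; rewrite eqd uv.
by rewrite -IH; apply: eq_dsum => a b _; rewrite eqd uv.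
Qed.

End Factorisations.

(** * Products compatible with deconcatenation *)

Section Compatible.
Variables (K : comNzRingType) (M : conomType).
Local Notation H := {malg K[mcomp M]}.
Local Notation HH := {malg K[(mcomp M * mcomp M)%type]}.
Local Notation e := (mcomp0 M).
Implicit Types (a b c : mcomp M) (m : mcomp M -> mcomp M -> H).

Definition Delta : H -> HH := linext (fun c => dsum c (fun a b => << (a, b) >>)).

Lemma deconcE : @deconc K M = Delta.
Proof. by rewrite /Delta bas.unlock -lin_extE. Qed.

Lemma DeltaU c : Delta (<< c >> : H) = dsum c (fun a b => << (a, b) >>).
Proof. exact: linextU. Qed.

Lemma Delta_linear : linear Delta.
Proof. exact: linext_linear. Qed.

Lemma counit_linear : scalar (@counit K M).
Proof. exact: mcoeff_linear. Qed.

Lemma DeltaP k (x y : H) : Delta (k *: x + y) = k *: Delta x + Delta y.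
Proof. exact: Delta_linear. Qed.

Lemma counitP k (x y : H) : counit (k *: x + y) = k * counit x + counit y.
Proof. exact: counit_linear. Qed.

Lemma counitU c : counit (<< c >> : H) = (c == e)%:R.
Proof. exact: mcoeff_basis. Qed.

Lemma bilin_dsuml (X Y : choiceType) (V : lmodType K) (f : X -> Y -> V) c
    (phi : mcomp M -> mcomp M -> {malg K[X]}) y :
  bilinext f (dsum c phi) y = dsum c (fun a b => bilinext f (phi a b) y).
Proof. exact: (linear_dsum _ _ (bilinext_linearl f y)). Qed.

Lemma bilin_dsumr (X Y : choiceType) (V : lmodType K) (f : X -> Y -> V) c
    (phi : mcomp M -> mcomp M -> {malg K[Y]}) x :
  bilinext f x (dsum c phi) = dsum c (fun a b => bilinext f x (phi a b)).
Proof. exact: (linear_dsum _ _ (bilinext_linearr f x)). Qed.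

Lemma lin_dsum (X : choiceType) (V : lmodType K) (f : X -> V) c phi :
  linext f (dsum c phi) = dsum c (fun a b => linext f (phi a b)).
Proof. exact: (linear_dsum _ _ (linext_linear f)). Qed.

(** The axioms of a Hopf algebra that involve the product, stated on compositions.
    The antipode comes for free because the coalgebra is connected. *)
Record compatible m : Prop := Compatible {
  compat0c : forall a, m e a = << a >>;
  compatc0 : forall a, m a e = << a >>;
  compatA : associative (bilinext m);
  compat_comul : forall a b, Delta (m a b) =
    dsum a (fun a1 a2 => dsum b (fun b1 b2 => tens (m a1 b1) (m a2 b2)));
  compat_counit : forall a b, counit (m a b) = ((a == e) && (b == e))%:R
}.

Section Hopf.
Variable m : mcomp M -> mcomp M -> H.
Hypothesis cm : compatible m.
Local Notation mul := (bilinext m).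
Local Notation one := (<< e >> : H).

Lemma compat1x : left_id one mul.
Proof.
apply: eq_on_basis => [k u v|//|a]; first by rewrite bilinextPr.
by rewrite bilinextUU compat0c.
Qed.

Lemma compatx1 : right_id one mul.
Proof.
apply: eq_on_basis => [k u v|//|a]; first by rewrite bilinextPl.
by rewrite bilinextUU compatc0.
Qed.

Lemma compat_comulM x y :
  Delta (mul x y) = tensor_mul mul (Delta x) (Delta y).
Proof.
rewrite tensor_mulE; move: x y; apply: eq_on_basis2 => [x|y|x|y|a b] /=.
- by move=> k u v; rewrite bilinextPr DeltaP.
- by move=> k u v; rewrite bilinextPl DeltaP.
- by move=> k u v; rewrite DeltaP bilinextPr.
- by move=> k u v; rewrite DeltaP bilinextPl.
rewrite bilinextUU compat_comul // !DeltaU.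
rewrite (linear_dsum _ _ (bilinext_linearl _ _)); apply: eq_dsum => a1 a2 _.
rewrite (linear_dsum _ _ (bilinext_linearr _ _)); apply: eq_dsum => b1 b2 _.
by rewrite !bilinextUU.
Qed.

Lemma compat_counitM x y : counit (mul x y) = counit x * counit y.
Proof.
move: x y; apply: (@eq_on_basis2 _ _ _ K^o) => [x|y|x|y|a b] /=.
- by move=> k u v; rewrite bilinextPr counitP.
- by move=> k u v; rewrite bilinextPl counitP.
- by move=> k u v; rewrite counitP mulrDr mulrCA.
- by move=> k u v; rewrite counitP mulrDl -mulrA.
by rewrite bilinextUU compat_counit // !counitU -natrM mulnb.
Qed.

Lemma is_antipodeE (S : H -> H) :
  is_antipode (mcomp_hopf mul) S <->
  [/\ linear S,
      forall c, dsum c (fun a b => mul (S << a >>) << b >>) = (c == e)%:R *: one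
    & forall c, dsum c (fun a b => mul << a >> (S << b >>)) = (c == e)%:R *: one].
Proof.
rewrite /is_antipode /= deconcE basE.
have key (S1 S2 : H -> H) c : linear S1 -> linear S2 ->
    tensor_lift mul (tensor_map S1 S2 (Delta << c >>))
    = dsum c (fun a b => mul (S1 << a >>) (S2 << b >>)).
  move=> h1 h2; rewrite tensor_liftE tensor_mapE DeltaU !lin_dsum.
  apply: eq_dsum => a b _; rewrite linextU -tensor_liftE.
  by rewrite tensor_liftT // => x; [exact: bilinext_linearr|exact: bilinext_linearl].
have lin (S1 S2 : H -> H) : linear (fun x : H => tensor_lift mul (tensor_map S1 S2 (Delta x))).
  by move=> k u v; rewrite tensor_liftE tensor_mapE DeltaP !linearP.
have lin1 : linear (fun x : H => counit x *: one).
  by move=> k u v /=; rewrite counitP scalerDl scalerA.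
have linid : linear (id : H -> H) by [].
split=> -[hS hl hr]; split=> // c.
- by rewrite -(key S id c hS linid) hl counitU.
- by rewrite -(key id S c linid hS) hr counitU.
- move: c; apply: (eq_on_basis (lin S id) lin1) => c.
  by rewrite (key S id c hS linid) hl counitU.
- move: c; apply: (eq_on_basis (lin id S) lin1) => c.
  by rewrite (key id S c linid hS) hr counitU.
Qed.

(** A right convolution inverse S of the identity is found by recursion.  Put
    L := S * id.  Then L * S = S * (id * S) = S, so that L - counit is annihilated
    by S on the right; as S fixes the unit, L = counit by induction. *)
Lemma compat_antipode : exists S, is_antipode (mcomp_hopf mul) S.
Proof.
have [S0 eS] := dsum_rec (fun c => (c == e)%:R *: one)
                         (fun a v => - mul << a >> v).
have S0e : S0 e = one by rewrite eS dsum0 eqxx scale1r addr0.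
have hr c : dsum c (fun a b => mul << a >> (S0 b)) = (c == e)%:R *: one.
  rewrite dsum_split_left compat1x eS -addrA -dsumD dsum_eq0 ?addr0 //.
  by move=> a b _; case: ifP; rewrite ?addr0 // addNr.
have hl c : dsum c (fun a b => mul (S0 a) << b >>) = (c == e)%:R *: one.
  pose L d := dsum d (fun a b => mul (S0 a) << b >>).
  rewrite -/(L c); elim: {c}(nrow c).+1 {-2}c (ltnSn (nrow c)) => // n IH c hc.
  have e1 : dsum c (fun a b => mul (L a) (S0 b)) = S0 c.
    under eq_dsum => a b _ do rewrite /L bilin_dsuml.
    rewrite (dsumA c (fun x y z => mul (mul (S0 x) << y >>) (S0 z))).
    under eq_dsum => x w _.
      under eq_dsum => y z _ do rewrite -(compatA cm).
      rewrite -bilin_dsumr hr; over.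
    rewrite dsum_right ?eqxx ?scale1r ?compatx1 // => a b /negbTE ->.
    by rewrite scale0r bilinext0r.
  have e2 : dsum c (fun a b => mul ((a == e)%:R *: one) (S0 b)) = S0 c.
    rewrite dsum_left ?eqxx ?scale1r ?compat1x // => a b /negbTE ->.
    by rewrite scale0r bilinext0l.
  have : dsum c (fun a b => mul (L a - (a == e)%:R *: one) (S0 b)) = 0.
    under eq_dsum => a b _ do rewrite bilinextDl bilinextNl.
    by rewrite dsumD e1 -{1}e2 -dsumD dsum_eq0 // => a b _; rewrite subrr.
  rewrite dsum_rightP ?S0e ?compatx1 => [/subr0_eq //|a b eab /nrow_gt0 hb].
  rewrite IH ?subrr ?bilinext0l //.
  by rewrite -ltnS (leq_trans _ hc) // eab /= ltnS -[ltnLHS]addn0 ltn_add2l.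
exists (linext S0); apply/is_antipodeE; split; first exact: linext_linear.
  by move=> c; under eq_dsum => a b _ do rewrite linextU; exact: hl.
by move=> c; under eq_dsum => a b _ do rewrite linextU; exact: hr.
Qed.

Lemma compatible_hopf : is_hopf (mcomp_hopf mul).
Proof.
constructor; rewrite /= ?deconcE ?basE.
- exact: bilinext_linearr.
- exact: bilinext_linearl.
- exact: compatA.
- exact: compat1x.
- exact: compatx1.
- exact: Delta_linear.
- exact: counit_linear.
- rewrite !tensor_mapE tensor_assocE; apply: eq_on_basis => [k u v|k u v|c].
  + by rewrite DeltaP linearP.
  + by rewrite DeltaP !linearP.
  + rewrite DeltaU !lin_dsum.
    under eq_dsum => a b _.
      rewrite linextU /= DeltaU /tens bilin_dsuml.
      under eq_dsum => x y _ do rewrite bilinextUU.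
      over.
    rewrite (dsumA c (fun x y z => << (x, y, z) >>)).
    apply: eq_dsum => x w _.
    rewrite linextU /= DeltaU /tens bilin_dsumr lin_dsum.
    by apply: eq_dsum => y z _; rewrite bilinextUU linextU.
- rewrite tensor_liftE; apply: eq_on_basis => [k u v|//|c].
    by rewrite DeltaP linearP.
  rewrite DeltaU lin_dsum; under eq_dsum => a b _ do rewrite linextU counitU /=.
  by rewrite dsum_left ?eqxx ?scale1r // => a b /negbTE ->; rewrite scale0r.
- rewrite tensor_liftE; apply: eq_on_basis => [k u v|//|c].
    by rewrite DeltaP linearP.
  rewrite DeltaU lin_dsum; under eq_dsum => a b _ do rewrite linextU counitU /=.
  by rewrite dsum_right ?eqxx ?scale1r // => a b /negbTE ->; rewrite scale0r.
- by rewrite tensorE tensUU DeltaU dsum0.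
- exact: compat_comulM.
- by rewrite counitU eqxx.
- exact: compat_counitM.
- exact: compat_antipode.
Qed.

End Hopf.

Definition bialgebra_map m1 m2 (phi : H -> H) : Prop :=
  [/\ linear phi,
      phi << e >> = << e >>,
      {morph phi : x y / bilinext m1 x y >-> bilinext m2 x y},
      forall x, Delta (phi x) = tensor_map phi phi (Delta x)
    & forall x, counit (phi x) = counit x].

(** If S and T are the antipodes, then phi S and T phi are both left convolution
    inverses of phi, and such an inverse is unique by induction on the number of
    rows. *)
Lemma bialgebra_map_hopf m1 m2 phi : compatible m1 -> compatible m2 ->
  bialgebra_map m1 m2 phi ->
  hopf_morphism (mcomp_hopf (bilinext m1)) (mcomp_hopf (bilinext m2)) phi.
Proof.
move=> c1 c2 [hlin h1 hM hD hc]; constructor; rewrite /= ?deconcE ?basE;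
  [exact: hlin|exact: h1|exact: hM|exact: hD|exact: hc|].
move=> S T /(is_antipodeE m1)[Slin Sl _] /(is_antipodeE m2)[Tlin Tl _].
have phiS c : dsum c (fun a b => bilinext m2 (phi (S << a >>)) (phi << b >>))
    = (c == e)%:R *: << e >>.
  under eq_dsum => a b _ do rewrite -hM.
  rewrite -(linear_dsum c (fun a b => bilinext m1 (S << a >>) << b >>) hlin).
  by rewrite Sl (linear_PropZ _ _ hlin) h1.
have Tphi c : dsum c (fun a b => bilinext m2 (T (phi << a >>)) (phi << b >>))
    = (c == e)%:R *: << e >>.
  pose g (p : mcomp M * mcomp M) := bilinext m2 (T << p.1 >>) << p.2 >>.
  have Tg x : linext g (Delta x) = counit x *: << e >>.
    move: x; apply: eq_on_basis => [k u v|k u v|d].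
    + by rewrite DeltaP linearP.
    + by rewrite counitP scalerDl scalerA.
    + rewrite DeltaU lin_dsum counitU -Tl.
      by apply: eq_dsum => a b _; rewrite linextU.
  have gT x y : linext g (tens x y) = bilinext m2 (T x) y.
    rewrite /g -(tensor_liftE (fun x y => bilinext m2 (T x) y)) tensor_liftT //.
      by move=> u; exact: bilinext_linearr.
    by move=> u k v w /=; rewrite Tlin bilinextPl.
  rewrite -counitU -hc -Tg hD DeltaU tensor_mapE !lin_dsum.
  by apply: eq_dsum => a b _; rewrite linextU gT.
apply: eq_on_basis => [k u v|k u v|c]; rewrite ?Slin ?hlin ?Tlin //.
elim: {c}(nrow c).+1 {-2}c (ltnSn (nrow c)) => // n IH c hn.
have : dsum c (fun a b =>
    bilinext m2 (phi (S << a >>) - T (phi << a >>)) (phi << b >>)) = 0.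
  under eq_dsum => a b _ do rewrite bilinextDl bilinextNl.
  by rewrite dsumD phiS -(Tphi c) -dsumD dsum_eq0 // => a b _; rewrite subrr.
rewrite dsum_rightP ?h1 ?compatx1 // => [/subr0_eq //|a b eab /nrow_gt0 hb].
rewrite IH ?subrr ?bilinext0l //.
by rewrite -ltnS (leq_trans _ hn) // eab /= ltnS -[ltnLHS]addn0 ltn_add2l.
Qed.

Lemma bialgebra_map_comp m1 m2 m3 phi psi :
  bialgebra_map m1 m2 phi -> bialgebra_map m2 m3 psi ->
  bialgebra_map m1 m3 (psi \o phi).
Proof.
move=> [l1 u1 M1 D1 c1] [l2 u2 M2 D2 c2]; split => /=.
- by move=> k x y /=; rewrite l1 l2.
- by rewrite u1 u2.
- by move=> x y /=; rewrite M1 M2.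
- move=> x; rewrite D2 D1; move: {D1 D2}(Delta x).
  rewrite !tensor_mapE; apply: eq_on_basis => [k u v|k u v|[a b]].
  + by rewrite !linearP.
  + by rewrite linearP.
  + by rewrite !linextU -tensor_mapE tensor_mapT.
- by move=> x; rewrite c2 c1.
Qed.

Lemma bialgebra_map_inv m1 m2 phi psi : cancel phi psi -> cancel psi phi ->
  bialgebra_map m1 m2 phi -> bialgebra_map m2 m1 psi.
Proof.
move=> pK qK [l1 u1 M1 D1 c1].
have l2 : linear psi by move=> k x y; rewrite -[LHS]pK -[RHS]pK qK l1 !qK.
split; first exact: l2.
- by rewrite -u1 pK.
- by move=> x y /=; rewrite -[RHS]pK M1 !qK.
- move=> x; rewrite -{2}[x]qK D1; move: (Delta (psi x)).
  rewrite !tensor_mapE; apply: eq_on_basis => [k u v //|k u v|[a b]].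
  + by rewrite !linearP.
  + by rewrite linextU -tensor_mapE tensor_mapT // !pK tensUU.
- by move=> x; rewrite -c1 qK.
Qed.

End Compatible.

(** * The block shuffle and the number of blocks *)

Section BlockShuffle.
Variables (K : comNzRingType) (M : conomType).
Local Notation H := {malg K[mcomp M]}.
Local Notation e := (mcomp0 M).
Implicit Types (a b c u w : mcomp M) (m : mcomp M -> mcomp M -> H).

Lemma tensor_mulT m (x1 x2 y1 y2 : H) :
  tensor_mul (bilinext m) (tens x1 x2) (tens y1 y2) =
  tens (bilinext m x1 y1) (bilinext m x2 y2).
Proof.
rewrite tensor_mulE /tens; move: x2 y1 y2; move: x1.
move=> x1 x2 y1 y2; move: x1; apply: eq_on_basis => [k u v|k u v|a1].
- by rewrite !bilinextPl.
- by rewrite !bilinextPl.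
move: x2; apply: eq_on_basis => [k u v|k u v|a2].
- by rewrite !(bilinextPl, bilinextPr).
- by rewrite !(bilinextPl, bilinextPr).
move: y1; apply: eq_on_basis => [k u v|k u v|b1].
- by rewrite !(bilinextPl, bilinextPr).
- by rewrite !(bilinextPl, bilinextPr).
move: y2; apply: eq_on_basis => [k u v|k u v|b2].
- by rewrite !(bilinextPl, bilinextPr).
- by rewrite !(bilinextPl, bilinextPr).
by rewrite !bilinextUU.
Qed.

Definition len c := size (blocks c).

Lemma len_diag_connected u w : connected u -> len (diag u w) = (len w).+1.
Proof. by move=> cu; rewrite /len blocks_diag_connected. Qed.

Lemma len0 : len e = 0%N. Proof. by rewrite /len blocks0. Qed.

Lemma len_diag a b : len (diag a b) = (len a + len b)%N.
Proof.
elim/mcomp_ind_diag: a => [|u a cu IH]; first by rewrite diag0c len0.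
by rewrite -diagA !(len_diag_connected _ cu) IH.
Qed.

Lemma len_gt0 c : c != e -> (0 < len c)%N.
Proof.
by elim/mcomp_ind_diag: c => [|u a cu _]; rewrite ?eqxx // len_diag_connected.
Qed.

Lemma len1_connected c : (len c == 1)%N -> connected c.
Proof.
elim/mcomp_ind_diag: c => [|u a cu _]; first by rewrite len0.
rewrite len_diag_connected // eqSS => /eqP la.
suff -> : a = e by rewrite diagc0.
by apply/eqP; apply: contraTT isT => /len_gt0; rewrite la.
Qed.

Lemma connected_len1 c : connected c -> len c = 1%N.
Proof. by move=> cc; rewrite -[c]diagc0 len_diag_connected // len0. Qed.

Definition dlin : H -> H -> H := bilinext (fun a b => << diag a b >>).

Lemma diag_linE : @diag_lin K M = dlin.
Proof. by rewrite /dlin bas.unlock -bilin_extE. Qed.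

Definition bsh : H -> H -> H := bilinext (@bshuffle_basis K M).

Lemma bsh1x : left_id << e >> bsh.
Proof.
apply: eq_on_basis => [k u v|//|a]; first by rewrite /bsh bilinextPr.
by rewrite /bsh bilinextUU bshuffle_basis0c basE.
Qed.

Lemma bshx1 : right_id << e >> bsh.
Proof.
apply: eq_on_basis => [k u v|//|a]; first by rewrite /bsh bilinextPl.
by rewrite /bsh bilinextUU bshuffle_basisc0 basE.
Qed.

(** Projection onto the span of the connected compositions along all others,
    rescaled by s. *)
Definition cproj (s : mcomp M -> K) : H -> H :=
  linext (fun c => if (len c == 1)%N then s c *: << c >> else 0).

Lemma cprojP s k x y : cproj s (k *: x + y) = k *: cproj s x + cproj s y.
Proof. exact: linext_linear. Qed.

Lemma cproj_ind (V : lmodType K) s (f g : H -> V) z :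
  linear f -> linear g ->
  (forall u, connected u -> f << u >> = g << u >>) ->
  f (cproj s z) = g (cproj s z).
Proof.
move=> hf hg e_fg; move: z; apply: eq_on_basis => [k x y|k x y|c].
- by rewrite cprojP hf.
- by rewrite cprojP hg.
rewrite /cproj linextU; case: ifP => [/len1_connected/e_fg h|_].
  by rewrite !linear_PropZ // h.
by rewrite !linear_Prop0.
Qed.

(** The recursion of the shuffle product, by multilinearity for first letters in
    the span of the connected compositions. *)
Lemma bsh_dlin s z z' x y :
  bsh (dlin (cproj s z) x) (dlin (cproj s z') y) =
  dlin (cproj s z) (bsh x (dlin (cproj s z') y)) +
  dlin (cproj s z') (bsh (dlin (cproj s z) x) y).
Proof.
rewrite /bsh /dlin.
apply: (@cproj_ind _ _ (fun p => bsh (dlin p x) (dlin (cproj s z') y))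
  (fun p => dlin p (bsh x (dlin (cproj s z') y)) +
                 dlin (cproj s z') (bsh (dlin p x) y))) => [k u v|k u v|a ca].
- by rewrite /bsh /dlin !(bilinextPl, bilinextPr).
- by rewrite /bsh /dlin !(bilinextPl, bilinextPr) scalerDr addrACA.
apply: (@cproj_ind _ _ (fun p => bsh (dlin << a >> x) (dlin p y))
  (fun p => dlin << a >> (bsh x (dlin p y)) +
                 dlin p (bsh (dlin << a >> x) y))) => [k u v|k u v|b cb].
- by rewrite /bsh /dlin !(bilinextPl, bilinextPr).
- by rewrite /bsh /dlin !(bilinextPl, bilinextPr) scalerDr addrACA.
move: x; apply: eq_on_basis => [k u v|k u v|c].
- by rewrite /bsh /dlin !(bilinextPl, bilinextPr).
- by rewrite /bsh /dlin !(bilinextPl, bilinextPr) scalerDr addrACA.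
move: y; apply: eq_on_basis => [k u v|k u v|d].
- by rewrite /bsh /dlin !(bilinextPl, bilinextPr).
- by rewrite /bsh /dlin !(bilinextPl, bilinextPr) scalerDr addrACA.
rewrite /bsh /dlin !bilinextUU bshuffle_basis_diag // diag_linE !basE.
by rewrite /dlin.
Qed.

(** A word is cut either before its first letter or after it. *)
Lemma Delta_dlin s z y :
  Delta (dlin (cproj s z) y) =
  tens << e >> (dlin (cproj s z) y)
  + linext (fun p => tens (dlin (cproj s z) << p.1 >>) << p.2 >>) (Delta y).
Proof.
move: y; apply: eq_on_basis => [k u v|k u v|c].
- by rewrite /dlin bilinextPr DeltaP.
- by rewrite /dlin /tens DeltaP linearP !bilinextPr scalerDr addrACA.
rewrite DeltaU lin_dsum; under eq_dsum => a b _ do rewrite linextU.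
apply: (@cproj_ind _ _ (fun p => Delta (dlin p << c >>))
  (fun p => tens << e >> (dlin p << c >>)
    + dsum c (fun a b => tens (dlin p << a >>) << b >>))) => [k u v|k u v|a ca].
- by rewrite /dlin bilinextPl DeltaP.
- rewrite /dlin /tens bilinextPl bilinextPr scalerDr addrACA; congr (_ + _).
  rewrite dsum_scalel -dsumD; apply: eq_dsum => a b _.
  by rewrite !bilinextPl.
rewrite /dlin bilinextUU DeltaU dsum_diag // tensUU; congr (_ + _).
by apply: eq_dsum => b d _; rewrite bilinextUU tensUU.
Qed.

Lemma counit_dlin s z y : counit (dlin (cproj s z) y) = 0.
Proof.
move: y; apply: (@eq_on_basis _ _ K^o (fun y => counit (dlin (cproj s z) y))
  (fun=> 0)) => [k u v|k u v|c].
- by rewrite /dlin bilinextPr counitP.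
- by rewrite scaler0 addr0.
apply: (@cproj_ind K^o _ (fun p => counit (dlin p << c >>))
  (fun=> 0)) => [k u v|k u v|a ca].
- by rewrite /dlin bilinextPl counitP.
- by rewrite scaler0 addr0.
by rewrite /dlin bilinextUU counitU diag_eq0 connected_eq0.
Qed.

(** The filtration by the number of blocks. *)
Definition lenlt n (x : H) := forall c, (n <= len c)%N -> x@_c = 0.

Lemma lenltW n n' x : (n <= n')%N -> lenlt n x -> lenlt n' x.
Proof. by move=> le h c hc; apply: h; apply: leq_trans hc. Qed.

Lemma lenlt0 x : lenlt 0 x -> x = 0.
Proof. by move=> h; apply/malgP => c; rewrite h // mcoeff0. Qed.

Lemma lenltD n x y : lenlt n x -> lenlt n y -> lenlt n (x + y).
Proof. by move=> hx hy c hc; rewrite mcoeffD hx ?hy ?addr0. Qed.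

Lemma lenltZ n k x : lenlt n x -> lenlt n (k *: x).
Proof. by move=> hx c hc; rewrite mcoeffZ hx ?mulr0. Qed.

Lemma lenlt_0 n : lenlt n 0.
Proof. by move=> c _; rewrite mcoeff0. Qed.

Lemma lenlt_dsum n c phi : (forall a b, c = diag a b -> lenlt n (phi a b)) ->
  lenlt n (dsum c phi).
Proof.
move=> h d hd; rewrite (@linear_dsum _ _ _ K^o (mcoeff d)).
  by apply: dsum_eq0 => a b eab; apply: h eab _ hd.
exact: mcoeff_linear.
Qed.

Lemma lenlt_bas c : lenlt (len c).+1 << c >>.
Proof. by move=> d; rewrite mcoeff_basis; case: eqVneq => // ->; rewrite ltnn. Qed.

Lemma lenlt_linear n n' (f : H -> H) x : linear f -> lenlt n x ->
  (forall c, (len c < n)%N -> lenlt n' (f << c >>)) -> lenlt n' (f x).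
Proof.
move=> hf hx h; rewrite (linextE_linear hf) -lin_extE /lin_ext => d hd.
rewrite raddf_sum big_seq big1 //= => c hc; rewrite mcoeffZ h ?mulr0 //.
by rewrite ltnNge; apply/negP => /hx/eqP; rewrite mcoeff_eq0 hc.
Qed.

Lemma lenlt_ex x : exists n, lenlt n x.
Proof.
exists (\max_(c <- msupp x) (len c).+1)%N => c; rewrite leqNgt => h.
apply/eqP; rewrite mcoeff_eq0; apply: contra h => hc.
by rewrite (big_rem c) //= leq_max leqnn.
Qed.

Lemma lenlt_dlin s z n y : lenlt n y -> lenlt n.+1 (dlin (cproj s z) y).
Proof.
move=> hy; apply: (lenlt_linear _ hy) => [|c hc]; first exact: bilinext_linearr.
have [k hk] := lenlt_ex z.
apply: (lenlt_linear (f := fun z => dlin (cproj s z) << c >>) _ hk) => [l u v|a _].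
  by rewrite cprojP /dlin bilinextPl.
rewrite /cproj linextU; case: ifP => [/len1_connected ca|_].
  rewrite /dlin bilinextZl bilinextUU; apply: lenltZ.
  by apply: lenltW (@lenlt_bas _); rewrite len_diag_connected.
by rewrite /dlin bilinext0l; exact: lenlt_0.
Qed.

(** The difference id - F lowers the number of blocks, so that it is locally
    nilpotent. *)
Lemma unitriangular_bij (F : mcomp M -> H) :
  (forall c, lenlt (len c) (<< c >> - F c)) -> bijective (linext F).
Proof.
move=> hF.
have low n x : lenlt n.+1 x -> lenlt n (x - linext F x).
  move=> hx; apply: (lenlt_linear (f := fun x => x - linext F x) _ hx).
    by move=> k u v; rewrite linearP opprD addrACA scalerBr.
  by move=> c hc; rewrite linextU; apply: lenltW (hF c).
have inj0 n x : lenlt n x -> linext F x = 0 -> x = 0.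
  elim: n x => [x /lenlt0 //|n IH x hx Fx]; apply: IH => //.
  by rewrite -[x]subr0 -Fx; exact: low.
have surj n y : lenlt n y -> exists x, linext F x = y.
  elim: n y => [y /lenlt0 ->|n IH y hy]; first by exists 0; rewrite linear0.
  have [x ex] := IH _ (low _ _ hy).
  by exists (x + y); rewrite linearD /= ex subrK.
have surjb y : exists x, linext F x == y.
  by have [n /surj[x /eqP]] := lenlt_ex y; exists x.
pose G y := xchoose (surjb y).
have FG : cancel G (linext F) by move=> y; exact: (eqP (xchooseP (surjb y))).
exists G => // x; apply/eqP; rewrite -subr_eq0; apply/eqP.
have [n hn] := lenlt_ex (G (linext F x) - x); apply: inj0 hn _.
by rewrite linearB /= FG subrr.
Qed.

Lemma bilinext_comm (m : mcomp M -> mcomp M -> H) :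
  (forall a b, m a b = m b a) ->
  forall x y : H, bilinext m x y = bilinext m y x.
Proof.
move=> mC; apply: eq_on_basis2 => [x|y|x|y|a b] /=.
- exact: bilinext_linearr.
- exact: bilinext_linearl.
- exact: bilinext_linearl.
- exact: bilinext_linearr.
by rewrite !bilinextUU mC.
Qed.

(** The last condition says that multiplication by the weight is a derivation. *)
Record graded_commutative (wt : mcomp M -> nat) m : Prop := GradedCommutative {
  gc0c : forall a, m e a = << a >>;
  gcC : forall a b, m a b = m b a;
  gcA : associative (bilinext m);
  gc_comul : forall a b, Delta (m a b) =
    dsum a (fun a1 a2 => dsum b (fun b1 b2 => tens (m a1 b1) (m a2 b2)));
  gc_wt : forall a b,
    linext (fun c => (wt c)%:R *: << c >>) (m a b) = (wt a + wt b)%N%:R *: m a b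
}.

End BlockShuffle.

(** * The Dynkin operator and the isomorphism with the block shuffle *)

Section DynkinIsomorphism.
Variables (K : comAlgType rat) (M : conomType).
Local Notation H := {malg K[mcomp M]}.
Local Notation e := (mcomp0 M).
Implicit Types (a b c u w : mcomp M) (m : mcomp M -> mcomp M -> H).

Definition natinv (n : nat) : K := (n%:R^-1 : rat)%:A.

Lemma natinvK n : n != 0%N -> natinv n * n%:R = 1.
Proof.
move=> n0; rewrite /natinv -(scaler_nat n (1 : K)) -[n%:R *: 1]/((n%:R : rat)%:A).
rewrite mulr_algl scalerA mulVf ?scale1r //.
by rewrite Num.Theory.pnatr_eq0.
Qed.

Lemma natr_scale_eq0 (V : lmodType K) n (x : V) : n != 0%N -> n%:R *: x = 0 -> x = 0.
Proof.
by move=> n0 h; rewrite -[x]scale1r -(natinvK n0) -scalerA h scaler0.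
Qed.

Section Isomorphism.
Variables (wt : mcomp M -> nat) (m : mcomp M -> mcomp M -> H).
Hypothesis wt0 : wt e = 0%N.
Hypothesis wt_gt0 : forall c, c != e -> wt c != 0%N.
Hypothesis gm : graded_commutative wt m.
Local Notation mul := (bilinext m).
Local Notation degree := (linext (fun c => (wt c)%:R *: << c >> : H)).

(** Multiplication by the weight erases the coefficient of the empty composition,
    but it multiplies a product by the sum of the weights of the factors. *)
Lemma gc_counit a b : counit (m a b) = ((a == e) && (b == e))%:R.
Proof.
case: (boolP (_ && _)) => [/andP[/eqP-> /eqP->]|nab]; first by rewrite (gc0c gm) counitU eqxx.
have deg0 (x : H) : (degree x)@_e = 0.
  move: x; apply: (@eq_on_basis _ _ K^o (fun x => (degree x)@_e) (fun=> 0)).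
  - by move=> k u v; rewrite linearP mcoeff_linear.
  - by move=> k u v; rewrite scaler0 addr0.
  move=> c; rewrite linextU mcoeffZ mcoeff_basis.
  by case: eqVneq => [->|_]; rewrite ?wt0 ?mul0r ?mulr0.
have := deg0 (m a b); rewrite (gc_wt gm) mcoeffZ /counit => h.
apply: (@natr_scale_eq0 K^o _ _ _ h); rewrite addn_eq0.
by apply: contra nab => /andP[ha hb]; apply/andP; split; apply: contraTT isT => /wt_gt0;
  rewrite ?ha ?hb.
Qed.

Lemma gc_compatible : compatible m.
Proof.
split.
- exact: (gc0c gm).
- by move=> a; rewrite (gcC gm) (gc0c gm).
- exact: (gcA gm).
- exact: (gc_comul gm).
- exact: gc_counit.
Qed.

(** The solution D of the convolution equation id * D = degree; in terms of the
    antipode S it is the Dynkin operator S * degree.  As degree is a derivation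
    and id is multiplicative, D kills products. *)
Lemma dynkin_exists : exists D : mcomp M -> H,
  (forall c, dsum c (fun a b => mul << a >> (D b)) = (wt c)%:R *: << c >>) /\
  (forall a b, linext D (m a b) = (b == e)%:R *: D a + (a == e)%:R *: D b).
Proof.
have [D eD] := dsum_rec (fun c => (wt c)%:R *: << c >> : H)
                        (fun a v => - mul << a >> v).
have id_D c : dsum c (fun a b => mul << a >> (D b)) = (wt c)%:R *: << c >>.
  rewrite dsum_split_left (compat1x gc_compatible) eD -addrA -dsumD.
  by rewrite dsum_eq0 ?addr0 // => a b _; case: ifP; rewrite ?addr0 // addNr.
have D0 : D e = 0 by rewrite eD dsum0 eqxx addr0 wt0 scale0r.
exists D; split=> // a b.
(* r is the expected value of D on a product. *)
pose r a b := (b == e)%:R *: D a + (a == e)%:R *: D b.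
have [n] := ubnP (nrow a + nrow b); elim: n a b => // n IH a b hn.
rewrite -/(r a b).
(* id * D = degree, evaluated at the product of a and b. *)
have e1 : dsum a (fun a1 a2 => dsum b (fun b1 b2 =>
    mul (m a1 b1) (linext D (m a2 b2)))) = (wt a + wt b)%N%:R *: m a b.
  rewrite -(gc_wt gm).
  have <- (x : H) : linext (fun p => mul << p.1 >> (D p.2)) (Delta x) = degree x.
    move: x; apply: eq_on_basis => [k u v|k u v|c].
    - by rewrite DeltaP linearP.
    - by rewrite linearP.
    rewrite DeltaU lin_dsum !linextU -id_D.
    by apply: eq_dsum => x y _; rewrite linextU.
  rewrite (gc_comul gm) lin_dsum; apply: eq_dsum => a1 a2 _.
  rewrite lin_dsum; apply: eq_dsum => b1 b2 _.
  rewrite /tens; move: (m a1 b1) (m a2 b2).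
  apply: eq_on_basis2 => [x|y|x|y|c d].
  - by move=> k u v; rewrite linearP bilinextPr.
  - by move=> k u v; rewrite bilinextPl.
  - by move=> k u v; rewrite bilinextPr linearP.
  - by move=> k u v; rewrite bilinextPl linearP.
  by rewrite bilinextUU !linextU.
(* With r instead of D, the convolution splits into (id * D)(a) b and
   a (id * D)(b), which add up to the same value as degree is a derivation. *)
have e2 : dsum a (fun a1 a2 => dsum b (fun b1 b2 =>
    mul (m a1 b1) (r a2 b2))) = (wt a + wt b)%N%:R *: m a b.
  transitivity (dsum a (fun a1 a2 => mul (m a1 b) (D a2))
              + dsum b (fun b1 b2 => mul (m a b1) (D b2))).
    have e_b a1 a2 : dsum b (fun b1 b2 => mul (m a1 b1) (r a2 b2)) =
        mul (m a1 b) (D a2) + (a2 == e)%:R *: dsum b (fun b1 b2 => mul (m a1 b1) (D b2)).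
      rewrite -(dsum_pick_right b (fun b1 _ => mul (m a1 b1) (D a2))).
      rewrite dsum_scalel -dsumD; apply: eq_dsum => b1 b2 _.
      rewrite /r bilinextDr.
      congr (_ + _); exact: bilinextZr.
    rewrite (eq_dsum (fun a1 a2 _ => e_b a1 a2)) dsumD; congr (_ + _).
    exact: dsum_pick_right.
  rewrite natrD scalerDl; congr (_ + _).
    rewrite -[m a b]bilinextUU -bilinextZl -id_D bilin_dsuml; apply: eq_dsum => a1 a2 _.
    rewrite -[m a1 b]bilinextUU -!(gcA gm); congr (mul _ _).
    exact: bilinext_comm (gcC gm) _ _.
  rewrite -[m a b]bilinextUU -bilinextZr -id_D bilin_dsumr.
  by apply: eq_dsum => b1 b2 _; rewrite -[m a b1]bilinextUU (gcA gm).
have : dsum a (fun a1 a2 => dsum b (fun b1 b2 =>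
    mul (m a1 b1) (linext D (m a2 b2) - r a2 b2))) = 0.
  under eq_dsum => a1 a2 _.
    under eq_dsum => b1 b2 _ do rewrite bilinextDr bilinextNr.
    over.
  under eq_dsum => a1 a2 _ do rewrite dsumD.
  rewrite dsumD e1 -e2 -dsumD dsum_eq0 // => a1 a2 _.
  by rewrite -dsumD dsum_eq0 // => b1 b2 _; rewrite subrr.
(* By induction the difference of the two convolutions has a single term, the
   one with trivial left factors. *)
have small a1 a2 b1 b2 : a = diag a1 a2 -> b = diag b1 b2 ->
    (a1 != e) || (b1 != e) -> linext D (m a2 b2) - r a2 b2 = 0.
  move=> ea eb h; rewrite IH ?subrr // -ltnS (leq_trans _ hn) // ltnS ea eb /=.
  case/orP: h => /nrow_gt0 h.
  - by rewrite -addSn leq_add ?leq_addl // -[ltnLHS]add0n ltn_add2r.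
  - by rewrite -addnS leq_add ?leq_addl // -[ltnLHS]add0n ltn_add2r.
rewrite dsum_leftP; last first.
  move=> a1 a2 ea h; apply: dsum_eq0 => b1 b2 eb.
  by rewrite (small _ _ _ _ ea eb) ?h // bilinext0r.
rewrite dsum_leftP; last first.
  move=> b1 b2 eb h; rewrite (small e a b1 b2) ?diag0c ?h ?orbT //.
  exact: bilinext0r.
by rewrite (gc0c gm) (compat1x gc_compatible) => /subr0_eq.
Qed.

(** The projection of the Dynkin operator to connected compositions, normalised
    to be the identity on these, is the component in cogenerators of the
    isomorphism onto the block shuffle. *)
Lemma indecomposable_proj : exists f : mcomp M -> H,
  [/\ forall c, exists z, f c = cproj (fun c => natinv (wt c)) z,
      f e = 0,
      forall u, connected u -> f u = << u >>
    & forall a b, linext f (m a b) = (b == e)%:R *: f a + (a == e)%:R *: f b].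
Proof.
have [D [id_D DM]] := dynkin_exists.
pose P := cproj (fun c => natinv (wt c)).
have Plin : linear P by move=> k x y; exact: cprojP.
have D0 : D e = 0.
  have := id_D e; rewrite dsum0 (compat1x gc_compatible) wt0 => ->.
  exact: scale0r.
exists (fun c => P (D c)); split=> [c||u cu|a b].
- by exists (D c).
- by rewrite D0 linear_Prop0.
(* The only factorisations of a connected u are (e, u) and (u, e). *)
- have := id_D u; rewrite -{1 2}[u]diagc0 dsum_diag // dsum0.
  rewrite (compat1x gc_compatible) D0 bilinext0r addr0 !diagc0 => ->.
  rewrite linear_PropZ // /P /cproj linextU connected_len1 // scalerA mulrC natinvK ?scale1r //.
  by apply: wt_gt0; rewrite connected_eq0.
- rewrite -(linear_PropZ _ _ Plin) -(linear_PropZ _ (D b) Plin).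
  have PD (x y : H) : P x + P y = P (x + y).
    by rewrite -[x in RHS]scale1r Plin scale1r.
  rewrite PD -DM; move: (m a b).
  apply: eq_on_basis => [k x y|k x y|c]; first exact: linext_linear.
    by rewrite linext_linear Plin.
  by rewrite !linextU.
Qed.

(** The coalgebra map F with component f in the cogenerators is multiplicative
    because f kills products, and it is unitriangular for the number of blocks
    because f is the identity on connected compositions. *)
Lemma block_shuffle_iso : exists F : H -> H,
  [/\ linear F /\ bijective F, F << e >> = << e >>,
      {morph F : x y / mul x y >-> bsh x y},
      forall x, Delta (F x) = tensor_map F F (Delta x)
    & forall x, counit (F x) = counit x].
Proof.
have [f [fP f0 fconn fM]] := indecomposable_proj.
have [F eF'] := dsum_rec (fun c => (c == e)%:R *: << e >> : H)
                         (fun a v => dlin (f a) v).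
(* F (w) = f (w1) F (w2), summed over the factorisations of a nonempty w; the
   term with w1 = e vanishes as f e = 0. *)
have eF c : F c = (c == e)%:R *: << e >> + dsum c (fun a b => dlin (f a) (F b)).
  rewrite eF'; congr (_ + _); apply: eq_dsum => a b _.
  by case: eqP => // ->; rewrite f0 /dlin bilinext0l.
have F0 : F e = << e >>.
  by rewrite eF dsum0 eqxx f0 /dlin bilinext0l addr0 scale1r.
have eFn c : c != e -> F c = dsum c (fun a b => dlin (f a) (F b)).
  by move=> /negbTE c0; rewrite eF c0 scale0r add0r.
have fstep a b c : c = diag a b -> a != e -> (nrow b < nrow c)%N.
  by move=> -> /nrow_gt0 ha; rewrite /= -[ltnLHS]add0n ltn_add2r.
have Fcounit c : counit (F c) = (c == e)%:R.
  rewrite eF counitP counitU eqxx mulr1 (@linear_dsum _ _ _ K^o (@counit K M)).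
    rewrite dsum_eq0 ?addr0 // => a b _.
    by have [z ->] := fP a; rewrite counit_dlin.
  exact: counit_linear.
have FDelta c : Delta (F c) = dsum c (fun a b => tens (F a) (F b)).
  have [n] := ubnP (nrow c); elim: n c => // n IH c hn.
  have Delta_f a b : c = diag a b -> Delta (dlin (f a) (F b)) =
      tens << e >> (dlin (f a) (F b)) +
      dsum b (fun x y => tens (dlin (f a) (F x)) (F y)).
    move=> eab; have [->|a0] := eqVneq a e.
      rewrite f0 /dlin /tens bilinext0l bilinext0r add0r linear_Prop0; last first.
        exact: Delta_linear.
      by rewrite dsum_eq0 // => x y _; rewrite !bilinext0l.
    have [z ->] := fP a; rewrite Delta_dlin IH; last first.
      by rewrite -ltnS (leq_trans _ hn) // ltnS (fstep _ _ _ eab).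
    rewrite lin_dsum; congr (_ + _); apply: eq_dsum => x y _.
    rewrite /tens; move: (F x) (F y); apply: eq_on_basis2 => [u|v|u|v|p q].
    - by move=> k ? ?; rewrite bilinextPr linearP.
    - by move=> k ? ?; rewrite bilinextPl linearP.
    - exact: bilinext_linearr.
    - by move=> k ? ?; rewrite /dlin bilinextPr bilinextPl.
    by rewrite bilinextUU linextU.
  have key : dsum c (fun a b => dsum b (fun x y => tens (dlin (f a) (F x)) (F y)))
      = dsum c (fun a b => tens (F a) (F b)) - tens << e >> (F c).
    rewrite -(dsumA c (fun x y z => tens (dlin (f x) (F y)) (F z))).
    apply/eqP; rewrite eq_sym subr_eq -(dsum_pick_left c (fun _ b => tens << e >> (F b))).
    rewrite -dsumD; apply/eqP; apply: eq_dsum => a b _.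
    by rewrite /tens {1}eF bilinextDl bilinextZl bilin_dsuml addrC.
  have split_e : (c == e)%:R *: tens << e >> << e >> +
      dsum c (fun a b => tens << e >> (dlin (f a) (F b))) = tens << e >> (F c).
    by rewrite [in RHS]eF /tens bilinextDr bilinextZr bilin_dsumr.
  rewrite {1}eF DeltaP DeltaU dsum0 (linear_dsum _ _ (@Delta_linear _ _)).
  by rewrite (eq_dsum Delta_f) dsumD key -tensUU addrA split_e addrC subrK.
exists (linext F); split.
- split; first exact: linext_linear.
  apply: unitriangular_bij => c.
  have [n] := ubnP (nrow c); elim: n c => // n IH c hn.
  have lenF b : (nrow b < n)%N -> lenlt (len b).+1 (F b).
    move=> hb; rewrite -[F b](subKr << b >>); apply: lenltD; first exact: lenlt_bas.
    by rewrite -scaleN1r; apply: lenltZ; apply: lenltW (IH b hb).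
  elim/mcomp_ind_diag: c hn => [|u w cu _] hn.
    by rewrite F0 subrr; exact: lenlt_0.
  have ltw : (nrow w < n)%N.
    by rewrite -ltnS (leq_trans _ hn) // ltnS (fstep u) ?connected_eq0.
  have uw0 : diag u w != e by rewrite diag_eq0 connected_eq0.
  (* The leading term of F (u w) is f (u) F (w) = u F (w); every other term is
     f (u a) F (b) with w = a b and a nonempty, and has fewer blocks. *)
  rewrite (eFn _ uw0) dsum_diag // f0.
  rewrite {1}/dlin bilinext0l add0r dsum_split_left diagc0 fconn // opprD addrA.
  apply: lenltD.
    have -> : << diag u w >> - dlin << u >> (F w) =
        dlin (cproj (fun=> 1) << u >>) (<< w >> - F w).
      rewrite /cproj linextU connected_len1 //= scale1r.
      by rewrite /dlin bilinextDr bilinextNr bilinextUU.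
    by rewrite len_diag_connected //; apply: lenlt_dlin; exact: IH.
  rewrite -scaleN1r; apply: lenltZ; apply: lenlt_dsum => a b eab.
  case: eqVneq => [_|a0]; first exact: lenlt_0.
  have [z ->] := fP (diag u a).
  apply: (@lenltW _ _ (len b).+2).
    by rewrite len_diag_connected // eab len_diag ltnS -[(len b).+1]add1n leq_add2r len_gt0.
  apply: lenlt_dlin; apply: lenF; rewrite (leq_ltn_trans _ ltw) //.
  by rewrite eab /= leq_addl.
- by rewrite linextU F0.
- have eFL x : linext F x = counit x *: << e >>
      + linext (fun p => dlin (f p.1) (F p.2)) (Delta x).
    move: x; apply: eq_on_basis => [k x y|k x y|c]; first exact: linext_linear.
      rewrite counitP DeltaP linext_linear scalerDl -scalerA scalerDr.
      exact: addrACA.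
    rewrite linextU eF counitU DeltaU lin_dsum; congr (_ + _).
    by apply: eq_dsum => a b _; rewrite linextU.
  have pairE x y : linext (fun p => dlin (f p.1) (F p.2)) (tens x y) =
      dlin (linext f x) (linext F y).
    rewrite /tens; move: x y; apply: eq_on_basis2 => [u|v|u|v|p q].
    - by move=> k ? ?; rewrite bilinextPr linearP.
    - by move=> k ? ?; rewrite bilinextPl linearP.
    - by move=> k ? ?; rewrite linext_linear /dlin bilinextPr.
    - by move=> k ? ?; rewrite linext_linear /dlin bilinextPl.
    by rewrite bilinextUU !linextU.
  apply: eq_on_basis2 => [u|v|u|v|a b].
  - by move=> k ? ?; rewrite bilinextPr linext_linear.
  - by move=> k ? ?; rewrite bilinextPl linext_linear.
  - by move=> k ? ?; rewrite linext_linear /bsh bilinextPr.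
  - by move=> k ? ?; rewrite linext_linear /bsh bilinextPl.
  rewrite bilinextUU !linextU.
  have [n] := ubnP (nrow a + nrow b); elim: n a b => // n IH a b hn.
  have [->|a0] := eqVneq a e; first by rewrite (gc0c gm) linextU F0 bsh1x.
  have [->|b0] := eqVneq b e.
    by rewrite (gcC gm) (gc0c gm) linextU F0 bshx1.
  rewrite eFL gc_counit (negbTE a0) scale0r add0r (gc_comul gm) lin_dsum.
  (* Since f kills products, f (a1 b1) is nonzero only if a1 or b1 is trivial. *)
  transitivity (dsum a (fun a1 a2 => dlin (f a1) (linext F (m a2 b)))
              + dsum b (fun b1 b2 => dlin (f b1) (linext F (m a b2)))).
    have e_b a1 a2 :
      linext (fun p => dlin (f p.1) (F p.2))
        (dsum b (fun b1 b2 => tens (m a1 b1) (m a2 b2))) =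
      dlin (f a1) (linext F (m a2 b))
      + (a1 == e)%:R *: dsum b (fun b1 b2 => dlin (f b1) (linext F (m a2 b2))).
      rewrite -(dsum_pick_left b (fun _ b2 => dlin (f a1) (linext F (m a2 b2)))).
      rewrite lin_dsum dsum_scalel -dsumD; apply: eq_dsum => b1 b2 _.
      rewrite pairE fM /dlin bilinextDl.
      by congr (_ + _); exact: bilinextZl.
    rewrite (eq_dsum (fun a1 a2 _ => e_b a1 a2)) dsumD; congr (_ + _).
    exact: (dsum_pick_left a (fun _ a2 =>
      dsum b (fun b1 b2 => dlin (f b1) (linext F (m a2 b2))))).
  have IHa a1 a2 : a = diag a1 a2 ->
      dlin (f a1) (linext F (m a2 b)) = dlin (f a1) (bsh (F a2) (F b)).
    move=> ea; have [->|h] := eqVneq a1 e; first by rewrite f0 /dlin !bilinext0l.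
    rewrite IH // -ltnS (leq_trans _ hn) // ltnS ltn_add2r.
    exact: fstep ea h.
  have IHb b1 b2 : b = diag b1 b2 ->
      dlin (f b1) (linext F (m a b2)) = dlin (f b1) (bsh (F a) (F b2)).
    move=> eb; have [->|h] := eqVneq b1 e; first by rewrite f0 /dlin !bilinext0l.
    rewrite IH // -ltnS (leq_trans _ hn) // ltnS ltn_add2l.
    exact: fstep eb h.
  rewrite (eq_dsum IHa) (eq_dsum IHb).
  have ea : dsum a (fun a1 a2 => dlin (f a1) (bsh (F a2) (F b))) =
      dsum a (fun a1 a2 => dsum b (fun b1 b2 =>
        dlin (f a1) (bsh (F a2) (dlin (f b1) (F b2))))).
    apply: eq_dsum => a1 a2 _; rewrite {1}(eFn b b0) /bsh /dlin.
    by rewrite !bilin_dsumr.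
  have eb : dsum b (fun b1 b2 => dlin (f b1) (bsh (F a) (F b2))) =
      dsum a (fun a1 a2 => dsum b (fun b1 b2 =>
        dlin (f b1) (bsh (dlin (f a1) (F a2)) (F b2)))).
    rewrite exchange_dsum; apply: eq_dsum => b1 b2 _.
    by rewrite {1}(eFn a a0) /bsh /dlin bilin_dsuml bilin_dsumr.
  (* The two sums are the two terms of the shuffle recursion. *)
  rewrite ea eb -dsumD {1}(eFn a a0) {1}(eFn b b0) /bsh bilin_dsuml.
  apply: eq_dsum => a1 a2 _; rewrite -dsumD bilin_dsumr.
  apply: eq_dsum => b1 b2 _.
  by have [z ->] := fP a1; have [z' ->] := fP b1; rewrite [RHS]bsh_dlin.
- move=> x; move: x; rewrite tensor_mapE.
  apply: eq_on_basis => [k x y|k x y|c].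
  + by rewrite linext_linear DeltaP.
  + by rewrite DeltaP linext_linear.
  + rewrite linextU FDelta DeltaU lin_dsum; apply: eq_dsum => a b _.
    by rewrite !linextU.
- apply: (@eq_on_basis _ _ K^o (fun x => counit (linext F x))) => [k x y|k x y|c].
  + by rewrite linext_linear counitP.
  + exact: counitP.
  + by rewrite linextU Fcounit counitU.
Qed.

(** Transport of structure along F. *)
Lemma block_shuffle_compatible : compatible (@bshuffle_basis K M).
Proof.
have [F [[Flin [G FK GK]] F1 FM FD Fc]] := block_shuffle_iso.
have bshE : bilinext (@bshuffle_basis K M) = @bsh K M by [].
have shM x y : bsh x y = F (mul (G x) (G y)) by rewrite FM !GK.
split.
- by move=> a; rewrite bshuffle_basis0c basE.
- by move=> a; rewrite bshuffle_basisc0 basE.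
- by move=> x y z; rewrite bshE !shM !FK (gcA gm).
- move=> a b; rewrite -bilinextUU bshE shM FD (compat_comulM gc_compatible).
  have FM2 p q : tensor_map F F (tensor_mul mul p q) =
      tensor_mul (@bsh K M) (tensor_map F F p) (tensor_map F F q).
    rewrite tensor_mapE; move: p q; apply: eq_on_basis2 => [u|v|u|v|[a1 a2] [b1 b2]].
    - by move=> k x y; rewrite tensor_mulE bilinextPr linext_linear.
    - by move=> k x y; rewrite tensor_mulE bilinextPl linext_linear.
    - by move=> k x y; rewrite linext_linear tensor_mulE bilinextPr.
    - by move=> k x y; rewrite linext_linear tensor_mulE bilinextPl.
    rewrite !linextU /bsh tensor_mulT -!tensUU tensor_mulT -tensor_mapE.
    by rewrite tensor_mapT // !FM.
  rewrite FM2 -!FD !GK !DeltaU tensor_mulE bilin_dsuml; apply: eq_dsum => a1 a2 _.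
  rewrite bilin_dsumr; apply: eq_dsum => b1 b2 _.
  by rewrite bilinextUU /bsh !bilinextUU.
- move=> a b; rewrite -bilinextUU bshE shM Fc (compat_counitM gc_compatible).
  by rewrite -(Fc (G << a >>)) -(Fc (G << b >>)) !GK !counitU -natrM mulnb.
Qed.

Lemma block_shuffle_bialgebra_map : exists F G : H -> H,
  [/\ bialgebra_map m (@bshuffle_basis K M) F,
      bialgebra_map (@bshuffle_basis K M) m G, cancel F G & cancel G F].
Proof.
have [F [[Flin [G FK GK]] F1 FM FD Fc]] := block_shuffle_iso.
have hF : bialgebra_map m (@bshuffle_basis K M) F by split.
exists F, G; split; [exact: hF|exact: (bialgebra_map_inv FK GK hF)|exact: FK|exact: GK].
Qed.

End Isomorphism.
End DynkinIsomorphism.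

(** * Increasing maps and quasi-shuffles *)

Definition incr (m n : nat) (f : {ffun 'I_m -> 'I_n}) : bool :=
  [forall i : 'I_m, forall j : 'I_m, (i < j)%N ==> (f i < f j)%N].

Definition fcomp (k m n : nat) (g : {ffun 'I_m -> 'I_n}) (f : {ffun 'I_k -> 'I_m}) :
  {ffun 'I_k -> 'I_n} := [ffun i => g (f i)].

Definition lhalf (m s n : nat) (g : {ffun 'I_(m + s) -> 'I_n}) :
  {ffun 'I_m -> 'I_n} := [ffun i => g (lshift s i)].
Definition rhalf (m s n : nat) (g : {ffun 'I_(m + s) -> 'I_n}) :
  {ffun 'I_s -> 'I_n} := [ffun i => g (rshift m i)].

Definition half_incr (m s n : nat) (g : {ffun 'I_(m + s) -> 'I_n}) : bool :=
  incr (lhalf g) && incr (rhalf g).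

Section Incr.

Lemma incrP (m n : nat) (f : {ffun 'I_m -> 'I_n}) :
  reflect {homo f : i j / (i < j)%N} (incr f).
Proof.
apply: (iffP forallP) => [h i j|h i]; first by move/forallP: (h i) => /(_ j)/implyP.
by apply/forallP => j; apply/implyP; apply: h.
Qed.

Lemma incr_mono (m n : nat) (f : {ffun 'I_m -> 'I_n}) :
  incr f -> {mono f : i j / (i < j)%N}.
Proof.
move=> /incrP h i j; apply/idP/idP => [|/h //].
apply: contraTT; rewrite -!leqNgt leq_eqVlt => /orP[/eqP/val_inj-> //|/h].
exact: ltnW.
Qed.

Lemma incr_inj (m n : nat) (f : {ffun 'I_m -> 'I_n}) : incr f -> injective f.
Proof.
move=> /incrP h i j e; case: (ltngtP i j) => [/h|/h|/val_inj //];
  by rewrite e ltnn.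
Qed.

Lemma is_qshE (m s j : nat) (q : {ffun 'I_(m + s) -> 'I_j}) :
  is_qsh q = surjb q && half_incr q.
Proof.
have el : incr (lhalf q) = [forall i : 'I_m, forall i' : 'I_m,
    (i < i')%N ==> (q (lshift s i) < q (lshift s i'))%N].
  by apply: eq_forallb => i; apply: eq_forallb => i'; rewrite !ffunE.
have er : incr (rhalf q) = [forall i : 'I_s, forall i' : 'I_s,
    (i < i')%N ==> (q (rshift m i) < q (rshift m i'))%N].
  by apply: eq_forallb => i; apply: eq_forallb => i'; rewrite !ffunE.
by rewrite /half_incr el er.
Qed.

Lemma sorted_enum_ord n (S : {set 'I_n}) : sorted ltn [seq val i | i <- enum S].
Proof.
rewrite sorted_map /enum_mem sorted_filter //.
  by move=> x y z; apply: ltn_trans.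
by rewrite -enumT -sorted_map val_enum_ord iota_ltn_sorted.
Qed.

Lemma enum_val_incr n (S : {set 'I_n}) : incr [ffun i : 'I_#|S| => enum_val i].
Proof.
apply/incrP => i j ij; rewrite !ffunE.
have x0 : 'I_n by exact: enum_val i.
rewrite !(enum_val_nth x0) -!(nth_map _ 0%N val) -?cardE //.
apply: (sorted_ltn_nth ltn_trans _ (sorted_enum_ord S)) => //;
  by rewrite inE size_map -cardE.
Qed.

(** An increasing map lists its image in increasing order. *)
Lemma incr_eq_imset m n (f g : {ffun 'I_m -> 'I_n}) : incr f -> incr g ->
  f @: setT = g @: setT -> f = g.
Proof.
move=> hf hg e.
have srt (h : {ffun 'I_m -> 'I_n}) : incr h ->
    sorted ltn [seq val (h i) | i <- enum 'I_m].
  move=> hh; rewrite sorted_map (eq_sorted (e' := relpre val ltn)).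
    by rewrite -sorted_map val_enum_ord iota_ltn_sorted.
  by move=> i j; rewrite /= incr_mono.
have : [seq val (f i) | i <- enum 'I_m] = [seq val (g i) | i <- enum 'I_m].
  apply: (irr_sorted_eq ltn_trans ltnn); [exact: srt|exact: srt|].
  have sub (h h' : {ffun 'I_m -> 'I_n}) : h @: setT = h' @: setT ->
      {subset [seq val (h i) | i <- enum 'I_m] <= [seq val (h' i) | i <- enum 'I_m]}.
    move=> eh x /mapP[i _ ->].
    have : h i \in h' @: setT by rewrite -eh imset_f.
    by case/imsetP => j _ ->; apply/mapP; exists j; rewrite ?mem_enum.
  by move=> x; apply/idP/idP; apply: sub; rewrite e.
move=> /eq_in_map h; apply/ffunP => i; apply: val_inj; apply: h.
by rewrite mem_enum.
Qed.

Lemma fcomp_incr_half m s j n (r : {ffun 'I_j -> 'I_n})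
    (p : {ffun 'I_(m + s) -> 'I_j}) :
  incr r -> half_incr (fcomp r p) = half_incr p.
Proof.
move=> hr.
have el : incr (lhalf (fcomp r p)) = incr (lhalf p).
  by apply: eq_forallb => i; apply: eq_forallb => i'; rewrite !ffunE incr_mono.
have er : incr (rhalf (fcomp r p)) = incr (rhalf p).
  by apply: eq_forallb => i; apply: eq_forallb => i'; rewrite !ffunE incr_mono.
by rewrite /half_incr el er.
Qed.

Lemma surjb_imset m j (p : {ffun 'I_m -> 'I_j}) : surjb p = (p @: setT == setT).
Proof.
apply/forallP/eqP => [h|h x].
  apply/setP => x; rewrite inE; have /existsP[i /eqP <-] := h x.
  exact: imset_f.
have : x \in p @: setT by rewrite h.
by case/imsetP => i _ ->; apply/existsP; exists i.
Qed.

Lemma imset_fcomp m j n (r : {ffun 'I_j -> 'I_n}) (p : {ffun 'I_m -> 'I_j}) :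
  surjb p -> fcomp r p @: setT = r @: setT.
Proof.
rewrite surjb_imset => /eqP <-; rewrite -imset_comp.
by apply: eq_imset => i; rewrite ffunE.
Qed.

(** Each map increasing on both halves is a quasi-shuffle followed by the
    increasing enumeration of its image, in a unique way. *)
Lemma half_incr_factor (V : nmodType) m s N (F : {ffun 'I_(m + s) -> 'I_N} -> V) :
  (0 < m + s)%N ->
  \sum_(g | half_incr g) F g =
  \sum_(1 <= j < (m + s).+1) \sum_(p : qsh m s j)
    \sum_(r : {ffun 'I_j -> 'I_N} | incr r) F (fcomp r (val p)).
Proof.
move=> ms0.
pose im (g : {ffun 'I_(m + s) -> 'I_N}) : 'I_(m + s).+1 := inord #|g @: setT|.
have imE g : im g = #|g @: setT| :> nat.
  by rewrite inordK // ltnS (leq_trans (leq_imset_card _ _)) // cardsT card_ord.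
(* The image is nonempty, which is why the sum over j may start at 1. *)
have im0 : \sum_(g | half_incr g && (im g == 0%N :> nat)) F g = 0.
  rewrite big_pred0 // => g; rewrite imE; case: eqP => [/eqP|_]; last by rewrite andbF.
  rewrite cards_eq0 => /eqP e0; have : g (Ordinal ms0) \in g @: setT by exact: imset_f.
  by rewrite e0 inE.
rewrite (partition_big im xpredT) //= -(big_mkord xpredT (fun j =>
  \sum_(g | half_incr g && (im g == j :> nat)) F g)) big_ltn // im0 add0r.
apply: eq_big_nat => j /andP[j0 jms].
rewrite pair_big_dep /=.
pose h (x : qsh m s j * {ffun 'I_j -> 'I_N}) := fcomp x.2 (val x.1).
rewrite -(big_imset (h := h) (A := [pred x | incr x.2])) /=; last first.
  move=> [p r] [p' r'] /=; rewrite !inE /= /h /= => hr hr' e.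
  have er : r = r'.
    apply: incr_eq_imset => //.
    by rewrite -(imset_fcomp r (qsh_surj p)) -(imset_fcomp r' (qsh_surj p')) e.
  subst r'; congr (_, _); apply/val_inj/ffunP => u.
  by move/ffunP: e => /(_ u); rewrite !ffunE => /(incr_inj hr).
apply: eq_bigl => g; rewrite imE; apply/andP/imsetP => [[hg /eqP e]|[[p r]]].
  subst j; have mem u : g u \in g @: setT by rewrite imset_f.
  pose r := [ffun i : 'I_#|g @: setT| => enum_val i].
  pose p := [ffun u => enum_rank_in (mem u) (g u)] :
    {ffun 'I_(m + s) -> 'I_#|g @: setT|}.
  have rp : g = fcomp r p by apply/ffunP => u; rewrite !ffunE enum_rankK_in.
  have hr : incr r := enum_val_incr _.
  have hp : is_qsh p.
    rewrite is_qshE -(fcomp_incr_half _ hr) -rp hg andbT.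
    apply/forallP => x; have /imsetP[u _ eu] := enum_valP x.
    apply/existsP; exists u; apply/eqP/enum_val_inj.
    by rewrite ffunE enum_rankK_in.
  by exists (exist _ p hp, r); rewrite ?inE.
rewrite inE /= => hr ->; rewrite /h /= fcomp_incr_half //.
have := valP p; rewrite is_qshE => /andP[sp ->]; split=> //.
rewrite imset_fcomp // card_imset; last exact: incr_inj.
by rewrite cardsT card_ord.
Qed.

Lemma half_incr_split (V : nmodType) m s N
    (F : {ffun 'I_m -> 'I_N} -> {ffun 'I_s -> 'I_N} -> V) :
  \sum_(f | incr f) \sum_(g | incr g) F f g =
  \sum_(h : {ffun 'I_(m + s) -> 'I_N} | half_incr h) F (lhalf h) (rhalf h).
Proof.
rewrite pair_big /=.
pose glue (x : {ffun 'I_m -> 'I_N} * {ffun 'I_s -> 'I_N}) :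
    {ffun 'I_(m + s) -> 'I_N} :=
  [ffun i => match split i with inl j => x.1 j | inr j => x.2 j end].
have lg x : lhalf (glue x) = x.1.
  by apply/ffunP => i; rewrite !ffunE -[lshift s i]/(unsplit (inl i)) unsplitK.
have rg x : rhalf (glue x) = x.2.
  by apply/ffunP => i; rewrite !ffunE -[rshift m i]/(unsplit (inr i)) unsplitK.
rewrite (reindex_onto (fun h => (lhalf h, rhalf h)) glue) /=.
  apply: eq_bigl => h; rewrite /half_incr andb_idr // => _; apply/eqP/ffunP => i.
  by rewrite ffunE; case: split_ordP => j ->; rewrite ffunE.
by case=> f g _; rewrite lg rg.
Qed.

End Incr.

(** * Evaluation of compositions in grids *)

(** A separate name for matrices, carrying entrywise multiplication. *)
Definition grid (M : conomType) (N L : nat) := 'M[M]_(N, L).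

Section Grid.
Variables (M : conomType) (N L : nat).

HB.instance Definition _ := Choice.on (grid M N L).

Definition grid_one : grid M N L := const_mx mone.
Definition grid_mul (A B : grid M N L) : grid M N L :=
  \matrix_(i, j) mmul (A i j) (B i j).

Lemma grid_mulA : associative grid_mul.
Proof. by move=> A B C; apply/matrixP => i j; rewrite !mxE mulmA. Qed.

Lemma grid_mul1m : left_id grid_one grid_mul.
Proof. by move=> A; apply/matrixP => i j; rewrite !mxE mul1m. Qed.

Lemma grid_mulm1 : right_id grid_one grid_mul.
Proof. by move=> A; apply/matrixP => i j; rewrite !mxE mulm1. Qed.

Lemma grid_unitm A B : grid_mul A B = grid_one -> A = grid_one /\ B = grid_one.
Proof.
move=> /matrixP h; split; apply/matrixP => i j; move: (h i j); rewrite !mxE;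
  by move=> /unitm[].
Qed.

Lemma grid_mulC : commutative grid_mul.
Proof. by move=> A B; apply/matrixP => i j; rewrite !mxE mulmC. Qed.

HB.instance Definition _ := Choice_isMonomialDef.Build (grid M N L)
  grid_mulA grid_mul1m grid_mulm1 grid_unitm.
HB.instance Definition _ := MonomialDef_isConomialDef.Build (grid M N L) grid_mulC.

End Grid.

(** Along surjections this merges rows and columns as in the quasi-shuffle; along
    increasing injections it inserts trivial rows and columns. *)
Definition push (M : conomType) (m n N L : nat) (g : {ffun 'I_m -> 'I_N})
    (h : {ffun 'I_n -> 'I_L}) (A : 'M[M]_(m, n)) : grid M N L :=
  \matrix_(x, y) \big[@mmul M/mone]_(u | g u == x)
                   \big[@mmul M/mone]_(v | h v == y) A u v.

Section Push.
Variable M : conomType.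

Lemma push_push m n N L N' L' (g : {ffun 'I_m -> 'I_N}) (h : {ffun 'I_n -> 'I_L})
    (g' : {ffun 'I_N -> 'I_N'}) (h' : {ffun 'I_L -> 'I_L'}) (A : 'M[M]_(m, n)) :
  push g' h' (push g h A) = push (fcomp g' g) (fcomp h' h) A.
Proof.
apply/matrixP => X Y; rewrite !mxE.
transitivity (\big[@mmul M/mone]_(x | g' x == X) \big[@mmul M/mone]_(u | g u == x)
    \big[@mmul M/mone]_(v | h' (h v) == Y) A u v).
  apply: eq_bigr => x _.
  transitivity (\big[@mmul M/mone]_(y | h' y == Y)
      \big[@mmul M/mone]_(u | g u == x) \big[@mmul M/mone]_(v | h v == y) A u v).
    by apply: eq_bigr => y _; rewrite mxE.
  rewrite exchange_big; apply: eq_bigr => u _.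
  rewrite [RHS](partition_big h (fun y => h' y == Y)) //.
  apply: eq_bigr => y /eqP hy; apply: eq_bigl => v.
  by case: (h v =P y) => [->|_]; rewrite ?andbF // hy eqxx.
rewrite [RHS](partition_big g (fun x => g' x == X)) => [|u]; last by rewrite ffunE.
apply: eq_bigr => x /eqP hx; apply: eq_big => [u|u _].
  by rewrite ffunE; case: (g u =P x) => [->|_]; rewrite ?andbF // hx eqxx.
by apply: eq_bigl => v; rewrite ffunE.
Qed.

Lemma push_block m n s t N L (g : {ffun 'I_(m + s) -> 'I_N})
    (h : {ffun 'I_(n + t) -> 'I_L}) (A : 'M[M]_(m, n)) (B : 'M[M]_(s, t)) :
  push g h (block_mx A (const_mx mone) (const_mx mone) B) =
  mmul (push (lhalf g) (lhalf h) A) (push (rhalf g) (rhalf h) B).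
Proof.
apply/matrixP => x y; rewrite !mxE big_split_ord /=; congr (mmul _ _).
  apply: eq_big => [u|u _]; first by rewrite ffunE.
  rewrite big_split_ord /= [X in mmul _ X]big1 ?mulm1.
    by apply: eq_big => [v|v _]; rewrite ?ffunE // block_mxEul.
  by move=> v _; rewrite block_mxEur mxE.
apply: eq_big => [u|u _]; first by rewrite ffunE.
rewrite big_split_ord /= big1 ?mul1m.
  by apply: eq_big => [v|v _]; rewrite ?ffunE // block_mxEdr.
by move=> v _; rewrite block_mxEdl mxE.
Qed.

Lemma push_in m n N L (g : {ffun 'I_m -> 'I_N}) (h : {ffun 'I_n -> 'I_L})
    (A : 'M[M]_(m, n)) u v : injective g -> injective h ->
  push g h A (g u) (h v) = A u v.
Proof.
move=> hg hh; rewrite mxE (big_pred1 u) => [|u']; last by rewrite inj_eq.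
by rewrite (big_pred1 v) // => v'; rewrite inj_eq.
Qed.

Lemma push_outl m n N L (g : {ffun 'I_m -> 'I_N}) (h : {ffun 'I_n -> 'I_L})
    (A : 'M[M]_(m, n)) x y : x \notin g @: setT -> push g h A x y = mone.
Proof.
move=> hx; rewrite mxE big_pred0 // => u; apply: contraNF hx => /eqP <-.
exact: imset_f.
Qed.

Lemma push_outr m n N L (g : {ffun 'I_m -> 'I_N}) (h : {ffun 'I_n -> 'I_L})
    (A : 'M[M]_(m, n)) x y : y \notin h @: setT -> push g h A x y = mone.
Proof.
move=> hy; rewrite mxE big1 // => u _; rewrite big_pred0 // => v.
by apply: contraNF hy => /eqP <-; exact: imset_f.
Qed.

Definition rsupp N L (A : grid M N L) := [set i | [exists j, A i j != mone]].
Definition csupp N L (A : grid M N L) := [set j | [exists i, A i j != mone]].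

Lemma rsupp_push N L (c : mcomp M) (g : {ffun 'I_(nrow c) -> 'I_N})
    (h : {ffun 'I_(ncol c) -> 'I_L}) : injective g -> injective h ->
  rsupp (push g h c) = g @: setT.
Proof.
move=> hg hh; apply/setP => x; rewrite inE; apply/existsP/imsetP => [[y hy]|[u _ ->]].
  have : x \in g @: setT by apply: contraR hy => /push_outl ->.
  by case/imsetP => u _ ->; exists u.
have [v hv] := (is_mcompP _ (mcompP c)).1 u.
by exists (h v); rewrite push_in.
Qed.

Lemma csupp_push N L (c : mcomp M) (g : {ffun 'I_(nrow c) -> 'I_N})
    (h : {ffun 'I_(ncol c) -> 'I_L}) : injective g -> injective h ->
  csupp (push g h c) = h @: setT.
Proof.
move=> hg hh; apply/setP => y; rewrite inE; apply/existsP/imsetP => [[x hx]|[v _ ->]].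
  have : y \in h @: setT by apply: contraR hx => /push_outr ->.
  by case/imsetP => v _ ->; exists v.
have [u hu] := (is_mcompP _ (mcompP c)).2 v.
by exists (g u); rewrite push_in.
Qed.

(** The grid A becomes the composition c once its trivial rows and columns are
    deleted. *)
Definition compresses N L (A : grid M N L) (c : mcomp M) : Prop :=
  exists (g : {ffun 'I_(nrow c) -> 'I_N}) (h : {ffun 'I_(ncol c) -> 'I_L}),
    [/\ incr g, incr h & push g h c = A].

(** A composition has no trivial row or column, so that the supports of the grid
    are the images of the two increasing maps, which determine these maps. *)
Lemma compresses_inj N L (A : grid M N L) c d :
  compresses A c -> compresses A d -> c = d.
Proof.
move=> [g [h [hg hh <-]]] [g' [h' [hg' hh' e]]].
have [ig ih ig' ih'] := And4 (incr_inj hg) (incr_inj hh) (incr_inj hg') (incr_inj hh').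
have er : g' @: setT = g @: setT by rewrite -(rsupp_push (c := d) ig' ih') e rsupp_push.
have ec : h' @: setT = h @: setT by rewrite -(csupp_push (c := d) ig' ih') e csupp_push.
have nr : nrow c = nrow d.
  by have := congr1 (fun S : {set 'I_N} => #|S|) er;
    rewrite !card_imset // !cardsT !card_ord => ->.
have nc : ncol c = ncol d.
  by have := congr1 (fun S : {set 'I_L} => #|S|) ec;
    rewrite !card_imset // !cardsT !card_ord => ->.
case: c d nr nc g h g' h' hg hh hg' hh' ig ih ig' ih' er ec e =>
  [m n A1 hA1] [m' n' A2 hA2] /= nr nc.
case: m' / nr A2 hA2 => A2 hA2; case: n' / nc A2 hA2 => A2 hA2.
move=> g h g' h' hg hh hg' hh' ig ih _ _ er ec.
have -> : g' = g by exact: incr_eq_imset.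
have -> : h' = h by exact: incr_eq_imset.
move=> e; have eA : A1 = A2.
  by apply/matrixP => i j; rewrite -(push_in A1 i j ig ih) -e push_in.
by case: A2 / eA hA2 {e} => hA2; congr MComp; apply: bool_irrelevance.
Qed.

Lemma compresses_ex N L (A : grid M N L) : exists c, compresses A c.
Proof.
pose g := [ffun i : 'I_#|rsupp A| => enum_val i].
pose h := [ffun j : 'I_#|csupp A| => enum_val j].
pose B := \matrix_(i, j) A (g i) (h j).
have sr x y : A x y != mone -> exists u, x = g u.
  move=> hA; have hx : x \in rsupp A by rewrite inE; apply/existsP; exists y.
  by exists (enum_rank_in hx x); rewrite ffunE enum_rankK_in.
have sc x y : A x y != mone -> exists v, y = h v.
  move=> hA; have hy : y \in csupp A by rewrite inE; apply/existsP; exists x.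
  by exists (enum_rank_in hy y); rewrite ffunE enum_rankK_in.
have hB : is_mcomp B.
  apply/is_mcompP; split=> [i|j].
    have := enum_valP i; rewrite inE => /existsP[y hy].
    by have [v ev] := sc _ _ hy; exists v; rewrite mxE -ev ffunE.
  have := enum_valP j; rewrite inE => /existsP[x hx].
  by have [u eu] := sr _ _ hx; exists u; rewrite mxE -eu ffunE.
exists (MComp hB); exists g, h; split; [exact: enum_val_incr|exact: enum_val_incr|].
have [ig ih] := (incr_inj (enum_val_incr (rsupp A)), incr_inj (enum_val_incr (csupp A))).
apply/matrixP => x y; apply/eqP; case: (eqVneq (A x y) mone) => [Axy|hA].
  have [/imsetP[u _ eu]|hx] := boolP (x \in g @: setT); last first.
    by rewrite push_outl // Axy.
  have [/imsetP[v _ ev]|hy] := boolP (y \in h @: setT); last first.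
    by rewrite push_outr // Axy.
  by rewrite eu ev push_in // mxE.
have [[u eu] [v ev]] := (sr _ _ hA, sc _ _ hA).
by rewrite eu ev push_in // mxE.
Qed.

Lemma compresses_self c : compresses (cmx c : grid M _ _) c.
Proof.
pose id_n n : {ffun 'I_n -> 'I_n} := [ffun i => i].
have hid n : incr (id_n n) by apply/incrP => i j; rewrite !ffunE.
exists (id_n _), (id_n _); split=> //; apply/matrixP => i j.
have <- : id_n _ i = i by rewrite ffunE.
have <- : id_n _ j = j by rewrite ffunE.
by rewrite push_in ?ffunE //; exact/incr_inj/hid.
Qed.

Definition grid_diag N1 L1 N2 L2 (A : grid M N1 L1) (B : grid M N2 L2) :
    grid M (N1 + N2) (L1 + L2) :=
  block_mx A (const_mx mone) (const_mx mone) B.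

Lemma compresses_diag N1 L1 N2 L2 (A : grid M N1 L1) (B : grid M N2 L2) a b :
  compresses A a -> compresses B b -> compresses (grid_diag A B) (diag a b).
Proof.
move=> [g1 [h1 [hg1 hh1 <-]]] [g2 [h2 [hg2 hh2 <-]]].
pose glue m s N1 N2 (f : {ffun 'I_m -> 'I_N1}) (f' : {ffun 'I_s -> 'I_N2}) :
    {ffun 'I_(m + s) -> 'I_(N1 + N2)} :=
  [ffun i => match split i with
             | inl j => lshift N2 (f j) | inr j => rshift N1 (f' j) end].
have gl m s P Q (f : {ffun 'I_m -> 'I_P}) (f' : {ffun 'I_s -> 'I_Q}) i :
    glue _ _ _ _ f f' (lshift s i) = lshift Q (f i).
  by rewrite ffunE -[lshift s i]/(unsplit (inl i)) unsplitK.
have gr m s P Q (f : {ffun 'I_m -> 'I_P}) (f' : {ffun 'I_s -> 'I_Q}) i :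
    glue _ _ _ _ f f' (rshift m i) = rshift P (f' i).
  by rewrite ffunE -[rshift m i]/(unsplit (inr i)) unsplitK.
have inc m s P Q (f : {ffun 'I_m -> 'I_P}) (f' : {ffun 'I_s -> 'I_Q}) :
    incr f -> incr f' -> incr (glue _ _ _ _ f f').
  move=> /incrP hf /incrP hf'; apply/incrP => i j.
  case: (split_ordP i) => i' ->; case: (split_ordP j) => j' ->; rewrite ?gl ?gr /=.
  - exact: hf.
  - by move=> _; apply: leq_trans (leq_addr _ _).
  - by rewrite ltnNge ltnW // (leq_trans (ltn_ord j')) // leq_addr.
  - by rewrite !ltn_add2l; apply: hf'.
exists (glue _ _ _ _ g1 g2), (glue _ _ _ _ h1 h2).
split; [exact: inc|exact: inc|rewrite push_block].
have [ig1 ih1 ig2 ih2] := And4 (incr_inj hg1) (incr_inj hh1) (incr_inj hg2) (incr_inj hh2).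
apply/matrixP => x y; rewrite mxE.
case: (split_ordP x) => x' ->; case: (split_ordP y) => y' ->.
- rewrite block_mxEul [X in mmul _ X]mxE big_pred0 ?mulm1.
    rewrite !mxE; apply: eq_big => [u|u _].
      by rewrite ffunE gl (inj_eq (@lshift_inj _ _)).
    by apply: eq_bigl => v; rewrite ffunE gl (inj_eq (@lshift_inj _ _)).
  by move=> u; rewrite ffunE gr eq_rlshift.
- rewrite block_mxEur !mxE big1 ?mul1m => [|u _]; last first.
    by rewrite big_pred0 // => v; rewrite ffunE gl eq_lrshift.
  by rewrite big_pred0 // => u; rewrite ffunE gr eq_rlshift.
- rewrite block_mxEdl !mxE big_pred0 ?mul1m => [|u]; last first.
    by rewrite ffunE gl eq_lrshift.
  by rewrite big1 // => u _; rewrite big_pred0 // => v; rewrite ffunE gr eq_rlshift.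
- rewrite block_mxEdr [X in mmul X _]mxE big_pred0 ?mul1m.
    rewrite !mxE; apply: eq_big => [u|u _].
      by rewrite ffunE gr (inj_eq (@rshift_inj _ _)).
    by apply: eq_bigl => v; rewrite ffunE gr (inj_eq (@rshift_inj _ _)).
  by move=> u; rewrite ffunE gl eq_lrshift.
Qed.

End Push.

(** * The two-parameter quasi-shuffle *)

Section Evaluation.
Variables (K : comNzRingType) (M : conomType).
Local Notation H := {malg K[mcomp M]}.
Local Notation e := (mcomp0 M).
Implicit Types (a b c : mcomp M).

Lemma malg_mulU (G : conomType) (A B : G) :
  (<< A >> : {malg K[G]}) * << B >> = << mmul A B >>.
Proof.
by rewrite -!basE malgM_def (fgmulUU 1 1 A B) mulr1.
Qed.

(** The monomial quasi-symmetric function of a composition, in N x L variables. *)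
Definition ev N L : H -> {malg K[grid M N L]} :=
  linext (fun a => \sum_(g : {ffun 'I_(nrow a) -> 'I_N} | incr g)
                     \sum_(h : {ffun 'I_(ncol a) -> 'I_L} | incr h)
                       << push g h a >>).

Lemma evP N L k x y : ev N L (k *: x + y) = k *: ev N L x + ev N L y.
Proof. exact: linext_linear. Qed.

(** Every grid occurs once in the evaluation of its compression, and in that of no
    other composition. *)
Lemma ev_coeff N L (A : grid M N L) a x : compresses A a -> (ev N L x)@_A = x@_a.
Proof.
move=> hA; move: x; apply: (@eq_on_basis _ _ K^o (fun x => (ev N L x)@_A)
  (mcoeff a)) => [k x y|k x y|b].
- by rewrite evP mcoeff_linear.
- exact: mcoeff_linear.
rewrite mcoeff_basis /ev linextU raddf_sum /=.
under eq_bigr => g _ do rewrite raddf_sum /=.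
have [eba|nba] := eqVneq b a; last first.
  rewrite big1 // => g hg; rewrite big1 // => h hh; rewrite mcoeff_basis.
  case: eqP => // eA; case/eqP: nba; apply: compresses_inj hA.
  by exists g, h.
have [g0 [h0 [hg0 hh0 eA]]] : compresses A b by rewrite eba.
have [ig ih] := (incr_inj hg0, incr_inj hh0).
have uniq g h : incr g -> incr h -> push g h b = A -> g = g0 /\ h = h0.
  move=> hg hh eA'; split; apply: incr_eq_imset => //.
    rewrite -(rsupp_push (c := b) ig ih) -(rsupp_push (c := b) (incr_inj hg) (incr_inj hh)).
    by rewrite eA eA'.
  rewrite -(csupp_push (c := b) ig ih) -(csupp_push (c := b) (incr_inj hg) (incr_inj hh)).
  by rewrite eA eA'.
rewrite (bigD1 g0) //= [X in _ + X]big1 ?addr0 => [|g /andP[hg ng]]; last first.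
  rewrite big1 // => h hh; rewrite mcoeff_basis; case: eqP => // eA'.
  by have [eg _] := uniq _ _ hg hh eA'; rewrite eg eqxx in ng.
rewrite (bigD1 h0) //= big1 ?addr0 => [|h /andP[hh nh]]; last first.
  rewrite mcoeff_basis; case: eqP => // eA'.
  by have [_ eh] := uniq _ _ hg0 hh eA'; rewrite eh eqxx in nh.
by rewrite mcoeff_basis eA eqxx.
Qed.

Lemma ev_self c x : (ev (nrow c) (ncol c) x)@_(cmx c : grid M _ _) = x@_c.
Proof. exact/ev_coeff/compresses_self. Qed.

Lemma ev_faithful x y : (forall N L, ev N L x = ev N L y) -> x = y.
Proof. by move=> h; apply/malgP => c; rewrite -!ev_self h. Qed.

Lemma ev_one N L : ev N L << e >> = 1.
Proof.
rewrite /ev linextU.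
have u n (f g : {ffun 'I_0 -> 'I_n}) : f = g by apply/ffunP => -[].
have inc n (f : {ffun 'I_0 -> 'I_n}) : incr f by apply/incrP => -[].
pose f0 n : {ffun 'I_0 -> 'I_n} := ffun0 (card_ord 0).
rewrite (big_pred1 (f0 N)) => [|f /=]; last by rewrite inc (u _ f (f0 N)) eqxx.
rewrite (big_pred1 (f0 L)) => [|f /=]; last by rewrite inc (u _ f (f0 L)) eqxx.
rewrite -basE; congr (mkmalgU _ _); apply/matrixP => x y.
by rewrite !mxE big_pred0 // => -[].
Qed.

Local Notation qsh2 := (@qshuffle2_basis K M).

Lemma qshuffle2E a b : a != e -> b != e ->
  qsh2 a b = \sum_(1 <= j < (nrow a + nrow b).+1) \sum_(1 <= k < (ncol a + ncol b).+1)
    \sum_(p : qsh (nrow a) (nrow b) j) \sum_(q : qsh (ncol a) (ncol b) k)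
      << @mcomp_merge M (diag a b) j k (val p) (val q) (qsh_surj p) (qsh_surj q) >>.
Proof. by move=> /negbTE a0 /negbTE b0; rewrite /qshuffle2_basis a0 b0 bas.unlock. Qed.

Lemma qshuffle2_0c a : qsh2 e a = << a >>.
Proof. by rewrite /qshuffle2_basis eqxx basE. Qed.

Lemma qshuffle2_c0 a : qsh2 a e = << a >>.
Proof. by rewrite /qshuffle2_basis eqxx bas.unlock; case: eqP => [->|]. Qed.

Lemma ncol_gt0 c : c != e -> (0 < ncol c)%N.
Proof.
move=> /nrow_gt0 h; have [j] := entry_row_neq h.
by case: (ncol c).
Qed.

(** Both sides count the ways of overlaying an increasing copy of a with an
    increasing copy of b in the grid. *)
Lemma ev_qshuffle2 N L a b : ev N L (qsh2 a b) = ev N L << a >> * ev N L << b >>.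
Proof.
have [->|a0] := eqVneq a e; first by rewrite qshuffle2_0c ev_one mul1r.
have [->|b0] := eqVneq b e; first by rewrite qshuffle2_c0 ev_one mulr1.
pose G g h : {malg K[grid M N L]} := << push g h (diag a b) >>.
transitivity (\sum_(g | half_incr g) \sum_(h | half_incr h) G g h); last first.
  transitivity (\sum_(g1 | incr g1) \sum_(g2 | incr g2) \sum_(h1 | incr h1)
    \sum_(h2 | incr h2) (<< mmul (push g1 h1 a) (push g2 h2 b) >> : {malg K[grid M N L]})).
    rewrite half_incr_split; apply: eq_bigr => g hg.
    rewrite (half_incr_split (fun h1 h2 =>
      << mmul (push (lhalf g) h1 a) (push (rhalf g) h2 b) >>)).
    by apply: eq_bigr => h hh; rewrite /G /= push_block.
  rewrite /ev !linextU mulr_suml; apply: eq_bigr => g1 _.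
  rewrite mulr_sumr; apply: eq_bigr => g2 _.
  rewrite mulr_suml; apply: eq_bigr => h1 _.
  by rewrite mulr_sumr; apply: eq_bigr => h2 _; rewrite malg_mulU.
rewrite (half_incr_factor (fun g => \sum_(h | half_incr h) G g h)); last first.
  by rewrite addn_gt0 nrow_gt0.
rewrite qshuffle2E // /ev linear_sum; apply: eq_bigr => j _.
transitivity (\sum_(p : qsh (nrow a) (nrow b) j) \sum_(r : {ffun 'I_j -> 'I_N} | incr r)
    \sum_(1 <= k < (ncol a + ncol b).+1) \sum_(q : qsh (ncol a) (ncol b) k)
      \sum_(s : {ffun 'I_k -> 'I_L} | incr s) G (fcomp r (val p)) (fcomp s (val q))).
  transitivity (\sum_(p : qsh (nrow a) (nrow b) j) \sum_(1 <= k < (ncol a + ncol b).+1)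
      \sum_(r : {ffun 'I_j -> 'I_N} | incr r) \sum_(q : qsh (ncol a) (ncol b) k)
      \sum_(s : {ffun 'I_k -> 'I_L} | incr s) G (fcomp r (val p)) (fcomp s (val q))).
    rewrite [RHS]exchange_big linear_sum; apply: eq_bigr => k _ /=.
    rewrite linear_sum; apply: eq_bigr => p _.
    rewrite linear_sum [RHS]exchange_big; apply: eq_bigr => q _ /=.
    rewrite linextU; apply: eq_bigr => r _; apply: eq_bigr => s _.
    by rewrite /G -push_push.
  by apply: eq_bigr => p _; exact: exchange_big.
apply: eq_bigr => p _; apply: eq_bigr => r _.
rewrite (half_incr_factor (fun h => G (fcomp r (val p)) h)) //.
by rewrite addn_gt0 ncol_gt0.
Qed.

Lemma ev_mul N L x y : ev N L (bilinext qsh2 x y) = ev N L x * ev N L y.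
Proof.
move: x y; apply: eq_on_basis2 => [x|y|x|y|a b].
- by move=> k u v; rewrite bilinextPr evP.
- by move=> k u v; rewrite bilinextPl evP.
- by move=> k u v; rewrite evP mulrDr scalerAr.
- by move=> k u v; rewrite evP mulrDl scalerAl.
by rewrite bilinextUU ev_qshuffle2.
Qed.

Lemma qshuffle2A : associative (bilinext qsh2).
Proof. by move=> x y z; apply: ev_faithful => N L; rewrite !ev_mul mulrA. Qed.

Lemma qshuffle2C a b : qsh2 a b = qsh2 b a.
Proof. by apply: ev_faithful => N L; rewrite !ev_qshuffle2 mulrC. Qed.

Lemma Delta_coeff (x : H) c1 c2 : (Delta x)@_(c1, c2) = x@_(diag c1 c2).
Proof.
move: x; apply: (@eq_on_basis _ _ K^o (fun x : H => (Delta x)@_(c1, c2))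
  (mcoeff (diag c1 c2))) => [k x y|k x y|c].
- by rewrite DeltaP mcoeff_linear.
- exact: mcoeff_linear.
by rewrite DeltaU dsum_pair_coeff mcoeff_basis.
Qed.

Section BlockDiagonal.
Variables N1 L1 N2 L2 : nat.
Local Notation G12 := (grid M (N1 + N2) (L1 + L2)).
Local Notation GG := (grid M N1 L1 * grid M N2 L2)%type.

Definition gul (A : G12) : grid M N1 L1 := ulsubmx A.
Definition gdr (A : G12) : grid M N2 L2 := drsubmx A.

Definition block_diagonal (A : G12) : bool := A == grid_diag (gul A) (gdr A).

(** As a product of elements of M is trivial only if both factors are, the grids
    that are not block diagonal span an ideal, so that discarding them is
    multiplicative. *)
Definition block_part : {malg K[G12]} -> {malg K[GG]} :=
  linext (fun A => if block_diagonal A then << (gul A, gdr A) >> else 0).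

(** The product of the tensor product of the two monoid algebras. *)
Definition pair_mul : {malg K[GG]} -> {malg K[GG]} -> {malg K[GG]} :=
  bilinext (fun p q => << (mmul p.1 q.1, mmul p.2 q.2) >>).

Lemma block_diagonal_mul A B :
  block_diagonal (mmul A B) = block_diagonal A && block_diagonal B.
Proof.
have crit (C : G12) : block_diagonal C <->
    ursubmx C = const_mx mone /\ dlsubmx C = const_mx mone.
  rewrite /block_diagonal /grid_diag /gul /gdr; split=> [/eqP e1|[eu ed]].
    by rewrite e1 block_mxKur block_mxKdl.
  by apply/eqP; rewrite -{1}[C]submxK eu ed.
apply/idP/andP => [/crit[/matrixP hu /matrixP hd]|[/crit[/matrixP au /matrixP ad]
    /crit[/matrixP bu /matrixP bd]]].
  split; apply/crit; split; apply/matrixP => i j; rewrite [RHS]mxE.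
  - by have := hu i j; rewrite !mxE => /unitm[].
  - by have := hd i j; rewrite !mxE => /unitm[].
  - by have := hu i j; rewrite !mxE => /unitm[].
  - by have := hd i j; rewrite !mxE => /unitm[].
apply/crit; split; apply/matrixP => i j.
  by have := au i j; have := bu i j; rewrite !mxE => -> ->; rewrite mulm1.
by have := ad i j; have := bd i j; rewrite !mxE => -> ->; rewrite mulm1.
Qed.

Lemma block_partM x y : block_part (x * y) = pair_mul (block_part x) (block_part y).
Proof.
rewrite /block_part /pair_mul; move: x y.
apply: eq_on_basis2 => [x|y|x|y|A B].
- by move=> k u v; rewrite mulrDr -scalerAr linext_linear.
- by move=> k u v; rewrite mulrDl -scalerAl linext_linear.
- by move=> k u v; rewrite linext_linear bilinextPr.
- by move=> k u v; rewrite linext_linear bilinextPl.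
rewrite malg_mulU !linextU block_diagonal_mul.
case: (block_diagonal A) => /=; last by rewrite bilinext0l.
case: (block_diagonal B) => /=; last by rewrite bilinext0r.
rewrite bilinextUU; congr (bas _ (_, _)); apply/matrixP => i j; by rewrite !mxE.
Qed.

Lemma block_part_coeff x A1 A2 : (block_part x)@_(A1, A2) = x@_(grid_diag A1 A2).
Proof.
move: x; apply: (@eq_on_basis _ _ K^o (fun x => (block_part x)@_(A1, A2))
  (mcoeff (grid_diag A1 A2))) => [k x y|k x y|B].
- by rewrite /block_part linext_linear mcoeff_linear.
- exact: mcoeff_linear.
rewrite /block_part linextU mcoeff_basis; case: ifP => hB; last first.
  rewrite mcoeff0; case: eqP => // eB; move: hB.
  by rewrite /block_diagonal eB /gul /gdr /grid_diag block_mxKul block_mxKdr eqxx.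
rewrite mcoeff_basis xpair_eqE; congr (nat_of_bool _)%:R.
apply/andP/eqP => [[/eqP <- /eqP <-]|->]; first exact/eqP.
by rewrite /gul /gdr /grid_diag block_mxKul block_mxKdr !eqxx.
Qed.

Lemma pair_mulT (x1 y1 : {malg K[grid M N1 L1]}) (x2 y2 : {malg K[grid M N2 L2]}) :
  pair_mul (tens x1 x2) (tens y1 y2) = tens (x1 * y1) (x2 * y2).
Proof.
rewrite /pair_mul /tens.
move: x1; apply: eq_on_basis => [k u v|k u v|a1].
- by rewrite !bilinextPl.
- by rewrite mulrDl -scalerAl bilinextPl.
move: x2; apply: eq_on_basis => [k u v|k u v|a2].
- by rewrite bilinextPr bilinextPl.
- by rewrite mulrDl -scalerAl bilinextPr.
move: y1; apply: eq_on_basis => [k u v|k u v|b1].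
- by rewrite bilinextPl bilinextPr.
- by rewrite mulrDr -scalerAr bilinextPl.
move: y2; apply: eq_on_basis => [k u v|k u v|b2].
- by rewrite !bilinextPr.
- by rewrite mulrDr -scalerAr bilinextPr.
by rewrite !bilinextUU !malg_mulU bilinextUU.
Qed.

(** The compression of a block diagonal grid is the diagonal sum of the
    compressions of its blocks. *)
Lemma block_part_ev c : block_part (ev _ _ << c >>) =
  dsum c (fun a b => tens (ev N1 L1 << a >>) (ev N2 L2 << b >>)).
Proof.
apply/malgP => -[A1 A2]; rewrite block_part_coeff.
have [a1 h1] := compresses_ex A1; have [a2 h2] := compresses_ex A2.
rewrite (ev_coeff _ (compresses_diag h1 h2)) -Delta_coeff DeltaU.
rewrite !(@linear_dsum _ _ _ K^o (mcoeff _)); try exact: mcoeff_linear.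
apply: eq_dsum => a b _.
by rewrite mcoeff_tens (ev_coeff _ h1) (ev_coeff _ h2) -tensUU mcoeff_tens.
Qed.

End BlockDiagonal.

(** At (c1, c2) the left side is the coefficient of a product of evaluations at the
    block diagonal grid with blocks c1 and c2, and taking block diagonal parts is
    multiplicative. *)
Lemma qshuffle2_comul a b : Delta (qsh2 a b) =
  dsum a (fun a1 a2 => dsum b (fun b1 b2 => tens (qsh2 a1 b1) (qsh2 a2 b2))).
Proof.
apply/malgP => -[c1 c2]; rewrite Delta_coeff -ev_self ev_qshuffle2.
rewrite -[cmx (diag c1 c2)]/(grid_diag (cmx c1 : grid M _ _) (cmx c2 : grid M _ _)).
rewrite -block_part_coeff block_partM !block_part_ev.
rewrite /pair_mul bilin_dsuml !(@linear_dsum _ _ _ K^o (mcoeff _));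
  try exact: mcoeff_linear.
apply: eq_dsum => a1 a2 _.
rewrite bilin_dsumr !(@linear_dsum _ _ _ K^o (mcoeff _)); try exact: mcoeff_linear.
apply: eq_dsum => b1 b2 _.
by rewrite -/(pair_mul _ _) pair_mulT !mcoeff_tens -!ev_qshuffle2 !ev_self.
Qed.

Section Weight.
Variable deg : M -> nat.
Hypothesis deg1 : deg mone = 0%N.
Hypothesis degM : forall x y, deg (mmul x y) = (deg x + deg y)%N.
Hypothesis deg0 : forall x, deg x = 0%N -> x = mone.

Definition wt c : nat := (\sum_i \sum_j deg (c i j))%N.

Lemma deg_prod (I : finType) (P : pred I) (F : I -> M) :
  deg (\big[@mmul M/mone]_(i | P i) F i) = (\sum_(i | P i) deg (F i))%N.
Proof. exact: (big_morph deg degM deg1). Qed.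

Lemma wt0 : wt e = 0%N.
Proof. by rewrite /wt big1 // => -[]. Qed.

Lemma wt_neq0 c : c != e -> wt c != 0%N.
Proof.
move=> /nrow_gt0 h; have [j hj] := (is_mcompP _ (mcompP c)).1 (Ordinal h).
apply: contra hj; rewrite /wt (bigD1 (Ordinal h)) //= addn_eq0 => /andP[].
by rewrite (bigD1 j) //= addn_eq0 => /andP[/eqP/deg0 -> _] _.
Qed.

Lemma wt_merge c (j k : nat) (p : {ffun 'I_(nrow c) -> 'I_j})
    (q : {ffun 'I_(ncol c) -> 'I_k}) (hp : surjb p) (hq : surjb q) :
  wt (mcomp_merge hp hq) = wt c.
Proof.
rewrite /wt /=.
transitivity (\sum_x \sum_(u | p u == x) \sum_v deg (c u v))%N.
  apply: eq_bigr => x _.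
  transitivity (\sum_y \sum_(u | p u == x) \sum_(v | q v == y) deg (c u v))%N.
    apply: eq_bigr => y _; rewrite mxE deg_prod; apply: eq_bigr => u _.
    exact: deg_prod.
  rewrite exchange_big; apply: eq_bigr => u _ /=.
  by rewrite [RHS](partition_big q xpredT).
by rewrite [RHS](partition_big p xpredT).
Qed.

Lemma wt_diag a b : wt (diag a b) = (wt a + wt b)%N.
Proof.
rewrite /wt /= big_split_ord /=; congr (_ + _)%N; apply: eq_bigr => i _.
  rewrite big_split_ord /= [X in (_ + X)%N]big1 ?addn0.
    by apply: eq_bigr => j _; rewrite block_mxEul.
  by move=> j _; rewrite block_mxEur mxE.
rewrite big_split_ord /= big1 ?add0n.
  by apply: eq_bigr => j _; rewrite block_mxEdr.
by move=> j _; rewrite block_mxEdl mxE.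
Qed.

Lemma qshuffle2_wt a b :
  linext (fun c => (wt c)%:R *: << c >>) (qsh2 a b) = (wt a + wt b)%N%:R *: qsh2 a b.
Proof.
have [->|a0] := eqVneq a e; first by rewrite qshuffle2_0c linextU wt0.
have [->|b0] := eqVneq b e; first by rewrite qshuffle2_c0 linextU wt0 addn0.
rewrite qshuffle2E // linear_sum scaler_sumr; apply: eq_bigr => j _.
rewrite linear_sum scaler_sumr; apply: eq_bigr => k _.
rewrite linear_sum scaler_sumr; apply: eq_bigr => p _.
rewrite linear_sum scaler_sumr; apply: eq_bigr => q _.
by rewrite -[LHS]/(linext _ _) linextU wt_merge wt_diag.
Qed.

Lemma qshuffle2_graded : graded_commutative wt qsh2.
Proof.
split.
- exact: qshuffle2_0c.
- exact: qshuffle2C.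
- exact: qshuffle2A.
- exact: qshuffle2_comul.
- exact: qshuffle2_wt.
Qed.

End Weight.
End Evaluation.

(** * The two-parameter shuffle *)

Section ShufflePermutations.

(** A surjection between sets of the same cardinality is injective. *)
Lemma qsh_inj m s (p : qsh m s (m + s)) : injective (val p).
Proof.
have := qsh_surj p; rewrite surjb_imset => /eqP e.
have /imset_injP h : #|val p @: setT| == #|[set: 'I_(m + s)]| by rewrite e !cardsT.
by move=> x y; apply: h; rewrite inE.
Qed.

Definition qsh_perm m s (p : qsh m s (m + s)) : 'S_(m + s) := perm (@qsh_inj m s p).

Lemma sh_half_incr m s (t : 'S_(m + s)) :
  (t \in sh m s) = half_incr [ffun i => t i].
Proof.
have el : incr (lhalf [ffun i => t i]) = [forall i : 'I_m, forall j : 'I_m,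
    (i < j)%N ==> (t (lshift s i) < t (lshift s j))%N].
  by apply: eq_forallb => i; apply: eq_forallb => i'; rewrite !ffunE.
have er : incr (rhalf [ffun i => t i]) = [forall i : 'I_s, forall j : 'I_s,
    (i < j)%N ==> (t (rshift m i) < t (rshift m j))%N].
  by apply: eq_forallb => i; apply: eq_forallb => i'; rewrite !ffunE.
by rewrite /half_incr el er inE.
Qed.

(** The quasi-shuffles onto m + s elements are the shuffles. *)
Lemma sh_sum_qsh (V : nmodType) m s (F : 'S_(m + s) -> V) :
  \sum_(t in sh m s) F t = \sum_(p : qsh m s (m + s)) F (qsh_perm p).
Proof.
pose h' (t : 'S_(m + s)) : option (qsh m s (m + s)) := insub [ffun i => t i].
have valE (p : qsh m s (m + s)) : [ffun i => qsh_perm p i] = val p.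
  by apply/ffunP => i; rewrite ffunE permE.
rewrite (reindex_omap (@qsh_perm m s) h') => [|t ht].
  apply: eq_bigl => p; rewrite sh_half_incr valE /h' valE valK eqxx andbT.
  by have := valP p; rewrite is_qshE => /andP[].
have ok : is_qsh [ffun i => t i].
  rewrite is_qshE -sh_half_incr ht andbT; apply/forallP => x; apply/existsP.
  by exists ((t^-1)%g x); rewrite ffunE permKV.
rewrite /h' insubT /=; congr Some; apply/permP => i.
by rewrite permE /= ffunE.
Qed.

End ShufflePermutations.

Section TopComponent.
Variables (K : comNzRingType) (M : conomType).
Local Notation H := {malg K[mcomp M]}.
Local Notation e := (mcomp0 M).
Local Notation qsh2 := (@qshuffle2_basis K M).
Local Notation sh2 := (@shuffle2_basis K M).
Implicit Types (a b c : mcomp M).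

Definition msize c := (nrow c + ncol c)%N.

(** The component of size n for the grading by rows plus columns, for which
    deconcatenation is homogeneous and the quasi-shuffle is filtered. *)
Definition top n : H -> H := linext (fun c => if msize c == n then << c >> else 0).

Definition msize_le n (x : H) := forall c, (n < msize c)%N -> x@_c = 0.

Lemma topP n k x y : top n (k *: x + y) = k *: top n x + top n y.
Proof. exact: linext_linear. Qed.

Lemma top_coeff n x c : (top n x)@_c = (msize c == n)%:R * x@_c.
Proof.
move: x; apply: (@eq_on_basis _ _ K^o (fun x => (top n x)@_c)
  (fun x => (msize c == n)%:R * x@_c)) => [k x y|k x y|b].
- by rewrite topP mcoeff_linear.
- by rewrite mcoeff_linear mulrDr mulrCA.
rewrite /top linextU mcoeff_basis; have [->|nbc] := eqVneq b c.
  by case: ifP; rewrite ?mul1r ?mul0r ?mcoeff0 ?mcoeff_basis ?eqxx.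
by rewrite mulr0; case: ifP; rewrite ?mcoeff0 // mcoeff_basis (negbTE nbc).
Qed.

Lemma msize_diag a b : msize (diag a b) = (msize a + msize b)%N.
Proof. by rewrite /msize /= addnACA. Qed.

Lemma msize0 : msize e = 0%N. Proof. by []. Qed.

Lemma qshuffle2_msize a b : msize_le (msize a + msize b)%N (qsh2 a b).
Proof.
move=> c hc.
have [ea|a0] := eqVneq a e.
  rewrite ea qshuffle2_0c mcoeff_basis; case: eqP => // ebc.
  by move: hc; rewrite ea ebc ltnn.
have [eb|b0] := eqVneq b e.
  rewrite eb qshuffle2_c0 mcoeff_basis; case: eqP => // eac.
  by move: hc; rewrite eb eac msize0 addn0 ltnn.
rewrite qshuffle2E // raddf_sum big_nat big1 //= => j /andP[_ hj].
rewrite raddf_sum big_nat big1 //= => k /andP[_ hk].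
rewrite raddf_sum big1 //= => p _; rewrite raddf_sum big1 //= => q _.
rewrite mcoeff_basis; case: eqP => // ec; move: hc.
by rewrite -ec /msize /= addnACA ltnNge leq_add.
Qed.

Lemma MComp_eq m n (A B : 'M[M]_(m, n)) (hA : is_mcomp A) (hB : is_mcomp B) :
  A = B -> MComp hA = MComp hB.
Proof. by move=> eAB; case: B / eAB hB => hB; congr MComp; apply: bool_irrelevance. Qed.

(** The shuffle product is the part of the quasi-shuffle product in which no
    rows and no columns are merged. *)
Lemma shuffle2_top a b : sh2 a b = top (msize a + msize b)%N (qsh2 a b).
Proof.
rewrite /shuffle2_basis.
have [->|a0] := eqVneq a e; first by rewrite qshuffle2_0c /top linextU eqxx basE.
have [->|b0] := eqVneq b e.
  by rewrite qshuffle2_c0 /top linextU msize0 addn0 eqxx basE.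
rewrite qshuffle2E //.
set m := nrow a; set s := nrow b; set n := ncol a; set t := ncol b.
have m0 : (0 < m + s)%N by rewrite addn_gt0 nrow_gt0.
have n0 : (0 < n + t)%N by rewrite addn_gt0 ncol_gt0.
(* Only the terms with j = m + s and k = n + t have the full size. *)
have topm j k (p : qsh m s j) (q : qsh n t k) :
    top (msize a + msize b)%N << @mcomp_merge M (diag a b) j k (val p) (val q)
      (qsh_surj p) (qsh_surj q) >> =
    if (j + k == m + s + (n + t))%N then << @mcomp_merge M (diag a b) j k
      (val p) (val q) (qsh_surj p) (qsh_surj q) >> else 0.
  by rewrite /top linextU /msize /= addnACA.
rewrite big_nat_recr //= {1}/top linearD /= [X in _ = X + _](_ : _ = 0) ?add0r; last first.
  rewrite linear_sum big_nat big1 //= => j /andP[_ hj].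
  rewrite linear_sum big_nat big1 //= => k /andP[_ hk].
  rewrite linear_sum big1 //= => p _; rewrite linear_sum big1 //= => q _.
  rewrite -/(top _ _) topm; case: eqP => // ejk; exfalso.
  have : (j + k < m + s + (n + t))%N.
    by rewrite -addSn leq_add.
  by rewrite ejk ltnn.
rewrite big_nat_recr //= linearD /= [X in _ = X + _](_ : _ = 0) ?add0r; last first.
  rewrite linear_sum big_nat big1 //= => k /andP[_ hk].
  rewrite linear_sum big1 //= => p _; rewrite linear_sum big1 //= => q _.
  rewrite -/(top _ _) topm eqn_add2l; case: eqP => // ek; exfalso.
  by move: hk; rewrite ek ltnn.
rewrite sh_sum_qsh linear_sum; apply: eq_bigr => p _.
rewrite sh_sum_qsh linear_sum; apply: eq_bigr => q _ /=.
rewrite -/(top _ _) topm eqxx basE; congr (bas _ _); apply: MComp_eq.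
apply/matrixP => x y; rewrite [LHS]mxE [RHS]mxE.
rewrite (big_pred1 ((qsh_perm p)^-1%g x)) => [|u /=]; last first.
  by rewrite -(can2_eq (permK _) (permKV _)) permE.
rewrite (big_pred1 ((qsh_perm q)^-1%g y)) // => v /=.
by rewrite -(can2_eq (permK _) (permKV _)) permE.
Qed.

Lemma eq_on_msize (V : lmodType K) (f g : H -> V) n x :
  linear f -> linear g -> msize_le n x ->
  (forall c, (msize c <= n)%N -> f << c >> = g << c >>) -> f x = g x.
Proof.
move=> hf hg hx h; rewrite (linextE_linear hf) (linextE_linear hg) -!lin_extE.
rewrite /lin_ext big_seq [RHS]big_seq; apply: eq_bigr => c hc.
rewrite h // leqNgt; apply/negP => /hx/eqP; rewrite mcoeff_eq0.
by rewrite hc.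
Qed.

(** Terms of x of size less than n contribute nothing of size n + msize c. *)
Lemma shuffle2_top_mul n x c : msize_le n x ->
  bilinext sh2 (top n x) << c >> = top (n + msize c)%N (bilinext qsh2 x << c >>).
Proof.
move=> hx; apply: (eq_on_msize (f := fun x => bilinext sh2 (top n x) << c >>)
  (g := fun x => top (n + msize c)%N (bilinext qsh2 x << c >>)) _ _ hx).
- by move=> k u v; rewrite topP bilinextPl.
- by move=> k u v; rewrite bilinextPl topP.
move=> d; rewrite leq_eqVlt => /orP[/eqP ed|hd].
  by rewrite {1}/top linextU ed eqxx !bilinextUU shuffle2_top ed.
rewrite {1}/top linextU (ltn_eqF hd) bilinext0l bilinextUU.
apply/malgP => b; rewrite top_coeff mcoeff0; case: eqP => [eb|_]; rewrite ?mul0r //.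
by rewrite qshuffle2_msize ?mulr0 // eb ltn_add2r.
Qed.

Lemma shuffle2_0c a : sh2 e a = << a >>.
Proof. by rewrite /shuffle2_basis eqxx basE. Qed.

Lemma shuffle2C a b : sh2 a b = sh2 b a.
Proof. by rewrite !shuffle2_top qshuffle2C addnC. Qed.

Lemma shuffle2A : associative (bilinext sh2).
Proof.
move=> x y z; move: x; apply: eq_on_basis => [k u v|k u v|a].
- by rewrite bilinextPl.
- by rewrite !bilinextPl.
move: y; apply: eq_on_basis => [k u v|k u v|b].
- by rewrite bilinextPl bilinextPr.
- by rewrite bilinextPr bilinextPl.
move: z; apply: eq_on_basis => [k u v|k u v|c].
- by rewrite !bilinextPr.
- by rewrite bilinextPr.
rewrite bilinext_comm; last exact: shuffle2C.
rewrite !bilinextUU !shuffle2_top !shuffle2_top_mul; try exact: qshuffle2_msize.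
rewrite (bilinext_comm (@qshuffle2C K M)) -[qsh2 b c]bilinextUU -[qsh2 a b]bilinextUU.
by rewrite qshuffle2A addnC addnA.
Qed.

Lemma Delta_top n x : Delta (top n x) =
  linext (fun p => if (msize p.1 + msize p.2 == n)%N then << p >> else 0) (Delta x).
Proof.
move: x; apply: eq_on_basis => [k u v|k u v|c].
- by rewrite topP DeltaP.
- by rewrite DeltaP linext_linear.
rewrite {1}/top linextU [in RHS]DeltaU lin_dsum.
case: ifP => hc.
  rewrite DeltaU; apply: eq_dsum => a b ec.
  by rewrite linextU /= -msize_diag -ec hc.
rewrite linear_Prop0; last exact: Delta_linear.
rewrite dsum_eq0 // => a b ec.
by rewrite linextU /= -msize_diag -ec hc.
Qed.

Lemma top_tens n1 n2 x y : msize_le n1 x -> msize_le n2 y ->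
  linext (fun p => if (msize p.1 + msize p.2 == n1 + n2)%N then << p >> else 0)
    (tens x y) = tens (top n1 x) (top n2 y).
Proof.
move=> hx hy; apply/malgP => -[c1 c2].
have coeffE z : (linext (fun p : mcomp M * mcomp M =>
    if (msize p.1 + msize p.2 == n1 + n2)%N then << p >> else 0) z)@_(c1, c2) =
    (msize c1 + msize c2 == n1 + n2)%N%:R * z@_(c1, c2) :> K.
  move: z; apply: (@eq_on_basis _ _ K^o (fun z => (linext _ z)@_(c1, c2))
    (fun z => _ * z@_(c1, c2))) => [k u v|k u v|p].
  - by rewrite linext_linear mcoeff_linear.
  - by rewrite mcoeff_linear mulrDr mulrCA.
  rewrite linextU mcoeff_basis; have [->|np] := eqVneq p (c1, c2).
    by case: ifP; rewrite ?mul1r ?mul0r ?mcoeff0 ?mcoeff_basis ?eqxx.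
  by rewrite mulr0; case: ifP; rewrite ?mcoeff0 // mcoeff_basis (negbTE np).
rewrite coeffE !mcoeff_tens !top_coeff.
have [h1|h1] := ltnP n1 (msize c1); first by rewrite hx // !(mulr0, mul0r).
have [h2|h2] := ltnP n2 (msize c2); first by rewrite hy // !(mulr0, mul0r).
rewrite mulrACA -natrM mulnb; congr (_%:R * _).
case: (ltngtP (msize c1) n1) h1 => // [lt _|-> _]; last by rewrite eqn_add2l.
by rewrite ltn_eqF // -addSn leq_add.
Qed.

Lemma shuffle2_comul a b : Delta (sh2 a b) =
  dsum a (fun a1 a2 => dsum b (fun b1 b2 => tens (sh2 a1 b1) (sh2 a2 b2))).
Proof.
rewrite shuffle2_top Delta_top qshuffle2_comul lin_dsum.
apply: eq_dsum => a1 a2 ea; rewrite lin_dsum; apply: eq_dsum => b1 b2 eb.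
rewrite !shuffle2_top ea eb !msize_diag addnACA top_tens //; exact: qshuffle2_msize.
Qed.

Lemma shuffle2_wt (deg : M -> nat) a b :
  deg mone = 0%N -> (forall x y, deg (mmul x y) = (deg x + deg y)%N) ->
  linext (fun c => (wt deg c)%:R *: << c >>) (sh2 a b)
  = (wt deg a + wt deg b)%N%:R *: sh2 a b.
Proof.
move=> deg1 degM; rewrite shuffle2_top.
have topC n x : linext (fun c => (wt deg c)%:R *: << c >>) (top n x) =
    top n (linext (fun c => (wt deg c)%:R *: << c >>) x).
  move: x; apply: eq_on_basis => [k u v|k u v|c].
  - by rewrite topP linext_linear.
  - by rewrite linext_linear topP.
  rewrite /top !linextU (linear_PropZ _ _ (@linext_linear _ _ _ _)) linextU.
  by case: ifP; rewrite ?linextU // linear0 scaler0.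
rewrite topC qshuffle2_wt //; exact: (linear_PropZ _ _ (@linext_linear _ _ _ _)).
Qed.

Lemma shuffle2_graded (deg : M -> nat) :
  deg mone = 0%N -> (forall x y, deg (mmul x y) = (deg x + deg y)%N) ->
  graded_commutative (wt deg) sh2.
Proof.
move=> deg1 degM; split.
- exact: shuffle2_0c.
- exact: shuffle2C.
- exact: shuffle2A.
- exact: shuffle2_comul.
- by move=> a b; exact: shuffle2_wt.
Qed.

End TopComponent.

(** * The isomorphism theorem *)

Lemma hopf_isomorphic_of_maps (K : comNzRingType) (M : conomType)
    (m1 m2 : mcomp M -> mcomp M -> {malg K[mcomp M]}) phi psi :
  compatible m1 -> compatible m2 -> bialgebra_map m1 m2 phi ->
  cancel phi psi -> cancel psi phi ->
  hopf_isomorphic (mcomp_hopf (bilin_ext m1)) (mcomp_hopf (bilin_ext m2)).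
Proof.
rewrite !bilin_extE => c1 c2 hphi phiK psiK; split.
- exact: compatible_hopf.
- exact: compatible_hopf.
exists phi; split; first exact: bialgebra_map_hopf.
by exists psi.
Qed.

(* K is a commutative Q-algebra; {cmonom 'I_d} is the free commutative monoid
   on d letters. *)
Theorem corollary5p6 (K : comAlgType rat) (d : nat) (hd : (1 <= d)%N) :
  hopf_isomorphic (mcomp_hopf (@bshuffle K {cmonom 'I_d}))
                  (mcomp_hopf (@shuffle2 K {cmonom 'I_d})) /\
  hopf_isomorphic (mcomp_hopf (@shuffle2 K {cmonom 'I_d}))
                  (mcomp_hopf (@qshuffle2 K {cmonom 'I_d})).
Proof.
(* The weight is the total number of letters. *)
have deg1 : mdeg (mone : {cmonom 'I_d}) = 0%N by exact: mdeg1.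
have degM : forall x y : {cmonom 'I_d}, mdeg (mmul x y) = (mdeg x + mdeg y)%N.
  exact: mdegM.
have deg0 : forall x : {cmonom 'I_d}, mdeg x = 0%N -> x = mone by exact: mdeg_eq0I.
have w0 := wt0 (@mdeg 'I_d).
have w1 := wt_neq0 deg0.
have gS := @shuffle2_graded K _ _ deg1 degM.
have gQ := @qshuffle2_graded K _ _ deg1 degM.
have [F1 [G1 [hF1 hG1 FK1 GK1]]] := block_shuffle_bialgebra_map w0 w1 gS.
have [F2 [G2 [hF2 hG2 FK2 GK2]]] := block_shuffle_bialgebra_map w0 w1 gQ.
have cS := gc_compatible w0 w1 gS; have cQ := gc_compatible w0 w1 gQ.
have cB := block_shuffle_compatible w0 w1 gS.
split; first exact: (hopf_isomorphic_of_maps cB cS hG1 GK1 FK1).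
apply: (hopf_isomorphic_of_maps (phi := G2 \o F1) (psi := G1 \o F2) cS cQ).
- exact: bialgebra_map_comp hF1 hG2.
- by move=> x /=; rewrite GK2 FK1.
- by move=> x /=; rewrite GK1 FK2.
Qed.
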